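(* Let $X=X(\Delta)$ be a complex toric variety of dimension $n$, let $\varphi=\varphi_A:X\dashrightarrow X$ be the monomial map associated with an $n\times n$ integer matrix $A$ with $\det(A)\neq0$, and let $Y\subset X$ be a closed subvariety of $X$. Then for all $P\in X_\varphi$, the set $$\{k\in\mathbb{N}\ :\ \varphi^k(P)\in Y\}$$ is a finite union of arithmetic progressions.
   Context: A toric variety $X=X(\Delta)$ is a normal variety containing an algebraic torus $\mathbb{T}\cong\mathbb{G}_{\mathrm m}^n(\mathbb{C})$ as a dense open subset such that the multiplication action of $\mathbb{T}$ on itself extends to an action on $X$; it is given by a (finite) fan $\Delta$ in $N_{\mathbb{R}}\cong\mathbb{R}^n$, where $N$ is the lattice of one-parameter subgroups of $\mathbb{T}$. For an $n\times n$ integer matrix $A=(a_{ij})$, the monomial map is $\varphi_A(x_1,\dots,x_n)=(x_1^{a_{11}}\cdots x_n^{a_{1n}},\dots,x_1^{a_{n1}}\cdots x_n^{a_{nn}})$ on $\mathbb{T}$; it extends to a rational self-map of $X$, still denoted $\varphi_A$. $X_\varphi$ is the set of points $P\in X$ whose forward $\varphi$-orbit is well-defined, i.e. $\varphi$ is defined (regular) at each of $P,\varphi(P),\varphi^2(P),\dots$. An arithmetic progression is a set $\{a+bk : k=0,1,2,\dots\}$ with integers $a,b\ge0$ (the case $b=0$, a single element, is allowed); the empty union is allowed. *)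

(* Defs.v *)
From HB Require Import structures.
From Stdlib Require Import Relation_Operators.
From mathcomp Require Import all_boot all_order all_algebra.
From mathcomp Require Import generic_quotient complex.
From mathcomp Require Import boolp classical_sets cardinality reals topology.

Set Implicit Arguments.
Unset Strict Implicit.
Unset Printing Implicit Defensive.

Import Order.TTheory GRing.Theory Num.Theory.

Local Open Scope classical_set_scope.
Local Open Scope ring_scope.
Local Open Scope quotient_scope.

(** Coordinates: the lattice of one-parameter subgroups is [N = Z^n], written
    as columns, and [M = Hom(N, Z)] is written as rows.  The field of complex
    numbers is [R[i]] for a [realType] [R]. *)

Section Cones.
Variables (R : realType) (n : nat).

Definition pairing (u : 'rV[R]_n) (v : 'cV[R]_n) : R := (u *m v) 0 0.

Definition rational_polyhedral (s : set 'cV[R]_n) : Prop :=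
  exists (r : nat) (g : 'I_r -> 'cV[int]_n),
    s = [set v | exists2 c : 'I_r -> R, (forall i, 0 <= c i) &
                 v = \sum_i c i *: map_mx intr (g i)].

Definition strongly_convex (s : set 'cV[R]_n) : Prop :=
  forall v, s v -> s (- v) -> v = 0.

Definition is_face (t s : set 'cV[R]_n) : Prop :=
  exists2 u : 'rV[R]_n, (forall v, s v -> 0 <= pairing u v) &
    t = s `&` [set v | pairing u v = 0].

Record fan := Fan {
  cones : set (set 'cV[R]_n);
  cones_finite : finite_set cones;
  cones_neq0 : cones !=set0;
  cones_rational : forall s, cones s -> rational_polyhedral s;
  cones_strongly_convex : forall s, cones s -> strongly_convex s;
  cones_face : forall s t, cones s -> is_face t s -> cones t;
  cones_meet : forall s t, cones s -> cones t ->
    is_face (s `&` t) s /\ is_face (s `&` t) t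
}.

(** The semigroup [S_s], i.e. the intersection of [M] with the dual of [s]. *)
Definition dual_semigroup (s : set 'cV[R]_n) : set 'rV[int]_n :=
  [set m | forall v, s v -> 0 <= pairing (map_mx intr m) v].

(** The closed points of [Spec C[S_s]], i.e. the monoid morphisms from [S_s] to
    the multiplicative monoid of [C].  They are extended by 0 outside [S_s], so
    that two points are equal as soon as they agree on [S_s]. *)
Record chart (s : set 'cV[R]_n) := Chart {
  chart_val :> 'rV[int]_n -> R[i];
  chart_val0 : chart_val 0 = 1;
  chart_valD : forall m1 m2, dual_semigroup s m1 -> dual_semigroup s m2 ->
    chart_val (m1 + m2) = chart_val m1 * chart_val m2;
  chart_val_out : forall m, ~ dual_semigroup s m -> chart_val m = 0
}.

(** The coordinate ring [C[S_s]], as a ring of functions on the chart: an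
    element is a finite sum of terms [c * chi^m] with [m] in [S_s]. *)
Definition coord_ring (s : set 'cV[R]_n) : set (chart s -> R[i]) :=
  [set f | exists2 l : seq (R[i] * 'rV[int]_n),
     (forall t, t \in l -> dual_semigroup s t.2) &
     forall x : chart s, f x = \sum_(t <- l) t.1 * x t.2].

End Cones.

Section ToricVariety.
Variables (R : realType) (n : nat) (D : fan R n).

Record chart_point := ChartPoint {
  cp_cone : set 'cV[R]_n;
  cp_mem : cones D cp_cone;
  cp_val : chart cp_cone
}.

HB.instance Definition _ := gen_eqMixin chart_point.
HB.instance Definition _ := gen_choiceMixin chart_point.

(** The charts of [s] and [t] are glued along the chart of [s `&` t]. *)
Definition glued (p q : chart_point) : Prop :=
  exists y : chart (cp_cone p `&` cp_cone q),
    {in dual_semigroup (cp_cone p), cp_val p =1 y} /\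
    {in dual_semigroup (cp_cone q), cp_val q =1 y}.

(** [glued] is in fact already an equivalence relation; taking the equivalence
    relation it generates only avoids having to prove this here. *)
Definition glued_eq : rel chart_point :=
  fun p q => `[< clos_refl_sym_trans _ glued p q >].

Lemma glued_eq_refl : reflexive glued_eq.
Proof. by move=> p; apply/asboolP; exact: rst_refl. Qed.

Lemma glued_eq_sym : symmetric glued_eq.
Proof.
by move=> p q; apply/asboolP/asboolP => h; exact: rst_sym.
Qed.

Lemma glued_eq_trans : transitive glued_eq.
Proof.
move=> q p r /asboolP pq /asboolP qr; apply/asboolP.
exact: rst_trans pq qr.
Qed.

Canonical glued_equiv :=
  EquivRel glued_eq glued_eq_refl glued_eq_sym glued_eq_trans.

Definition toric_variety : Type := {eq_quot glued_equiv}.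

HB.instance Definition _ := Choice.on toric_variety.

Definition of_chart (s : set 'cV[R]_n) (hs : cones D s) (x : chart s) :
  toric_variety := \pi_{eq_quot glued_equiv} (ChartPoint hs x).

(** Zariski topology: in every chart, the complement of the zero locus of a set
    of elements of the coordinate ring. *)
Definition zariski_open (U : set toric_variety) : Prop :=
  forall (s : set 'cV[R]_n) (hs : cones D s),
    exists2 I : set (chart s -> R[i]), I `<=` @coord_ring R n s &
      forall x, ~ U (of_chart hs x) <-> forall f, I f -> f x = 0.

Lemma coord_ringM (s : set 'cV[R]_n) (f g : chart s -> R[i]) :
  coord_ring f -> coord_ring g -> coord_ring (fun x => f x * g x).
Proof.
move=> [l hl fE] [k hk gE].
exists [seq (t.1 * u.1, t.2 + u.2) | t <- l, u <- k].
  move=> _ /allpairsP[[t u] /= [tl uk ->]] /= v sv.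
  rewrite map_mxD /pairing mulmxDl mxE addr_ge0 //.
    exact: hl.
  exact: hk.
move=> x; rewrite fE gE big_allpairs_dep mulr_suml.
rewrite big_seq [RHS]big_seq; apply: eq_bigr => t tl.
rewrite mulr_sumr big_seq [RHS]big_seq; apply: eq_bigr => u uk.
by rewrite (chart_valD x (hl _ tl) (hk _ uk)) mulrACA.
Qed.

Lemma zariski_openT : zariski_open setT.
Proof.
move=> s hs; exists (@coord_ring R n s) => // x.
split=> [/(_ I)//|h _].
have /eqP : (fun _ : chart s => 1 : R[i]) x = 0.
  apply: h; exists [:: (1, 0)] => [t|y].
    rewrite inE => /eqP -> v sv /=.
    by rewrite map_mx0 /pairing mul0mx mxE.
  by rewrite big_seq1 /= chart_val0 mulr1.
by rewrite oner_eq0.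
Qed.

Lemma zariski_openI : setI_closed zariski_open.
Proof.
move=> U V oU oV s hs.
have [I hI UE] := oU s hs; have [J hJ VE] := oV s hs.
exists [set h | exists f g, [/\ I f, J g & h = fun x => f x * g x]].
  by move=> _ [f [g [If Jg ->]]]; apply: coord_ringM; [exact: hI | exact: hJ].
move=> x; split.
  move=> /not_andP[/UE h _ [f [g [If Jg ->]]]|/VE h _ [f [g [If Jg ->]]]].
    by rewrite h ?mul0r.
  by rewrite [g x]h ?mulr0.
move=> h [Ux Vx].
have /existsNP[f /not_implyP[If f0]] : ~ forall f, I f -> f x = 0.
  by move/UE; apply.
have /existsNP[g /not_implyP[Jg g0]] : ~ forall g, J g -> g x = 0.
  by move/VE; apply.
have /eqP := h _ (ex_intro _ f (ex_intro _ g (And3 If Jg erefl))).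
by rewrite mulf_eq0 => /orP[] /eqP.
Qed.

Lemma zariski_open_bigcup (I : Type) (U : I -> set toric_variety) :
  (forall i, zariski_open (U i)) -> zariski_open (\bigcup_i U i).
Proof.
move=> oU s hs.
exists [set f | exists2 i, forall x, ~ U i (of_chart hs x) -> f x = 0 &
                coord_ring f] => [f [] //|x]; split.
  by move=> h f [i + _]; apply => Ui; apply: h; exists i.
move=> h [i _ Ui]; have [J hJ JE] := oU i s hs.
apply: (JE x).2 Ui => f Jf; apply: h; exists i; last exact: hJ.
by move=> y /JE; apply.
Qed.

HB.instance Definition _ := isOpenTopological.Build toric_variety
  zariski_openT zariski_openI zariski_open_bigcup.

Definition regular_on (V : set toric_variety) (f : toric_variety -> R[i]) :
  Prop :=
  forall P, V P -> exists (s : set 'cV[R]_n) (hs : cones D s) (g h : chart s -> R[i])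
      (W : set toric_variety),
    [/\ coord_ring g, coord_ring h, open_nbhs P W, W `<=` V &
     forall Q, W Q -> exists x : chart s,
       [/\ Q = of_chart hs x, h x != 0 & f Q = g x / h x]].

(** A morphism of varieties from the open subset [V] to the toric variety. *)
Definition morphism_on (V : set toric_variety)
    (psi : toric_variety -> toric_variety) : Prop :=
  [/\ open V, {within V, continuous psi} &
   forall (W : set toric_variety) (f : toric_variety -> R[i]),
     open W -> regular_on W f -> regular_on (V `&` psi @^-1` W) (f \o psi)].

End ToricVariety.

Section MonomialMap.
Variables (R : realType) (n : nat).

Record torus := Torus {
  torus_val :> 'I_n -> R[i];
  torus_neq0 : forall i, torus_val i != 0
}.

Lemma monomial_neq0 (m : 'I_n -> int) (t : torus) :
  \prod_j t j ^ m j != 0.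
Proof. by apply/prodf_neq0 => j _; rewrite expfz_neq0 ?torus_neq0. Qed.

Definition torus_map (A : 'M[int]_n) (t : torus) : torus :=
  Torus (fun i => monomial_neq0 (A i) t).

Definition torus_chart_val (s : set 'cV[R]_n) (t : torus) (m : 'rV[int]_n) :
    R[i] :=
  if `[< dual_semigroup s m >] then \prod_j t j ^ m 0 j else 0.

Lemma torus_chart_val0 s t : torus_chart_val s t 0 = 1.
Proof.
rewrite /torus_chart_val asboolT.
  by apply: big1 => j _; rewrite mxE expr0z.
by move=> v sv; rewrite map_mx0 /pairing mul0mx mxE.
Qed.

Lemma torus_chart_valD s t m1 m2 :
  dual_semigroup s m1 -> dual_semigroup s m2 ->
  torus_chart_val s t (m1 + m2) = torus_chart_val s t m1 * torus_chart_val s t m2.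
Proof.
move=> h1 h2; rewrite /torus_chart_val !asboolT //.
  rewrite -big_split /=; apply: eq_bigr => j _.
  by rewrite mxE expfzDr // torus_neq0.
by move=> v sv; rewrite map_mxD /pairing mulmxDl mxE addr_ge0 ?h1 ?h2.
Qed.

Lemma torus_chart_val_out s t m :
  ~ dual_semigroup s m -> torus_chart_val s t m = 0.
Proof. by move=> h; rewrite /torus_chart_val asboolF. Qed.

Definition torus_chart (s : set 'cV[R]_n) (t : torus) : chart s :=
  Chart (torus_chart_val0 s t) (@torus_chart_valD s t)
        (@torus_chart_val_out s t).

Variable D : fan R n.

(** The embedding of the torus can be read in any chart, see
    [of_torusE]. *)
Definition of_torus (t : torus) : toric_variety D :=
  of_chart (projT2 (cid (cones_neq0 D))) (torus_chart _ t).

Lemma of_torusE (s : set 'cV[R]_n) (hs : cones D s) (t : torus) :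
  of_torus t = of_chart hs (torus_chart s t).
Proof.
apply/eqmodP/asboolP/rst_step; rewrite /glued /=.
exists (torus_chart _ t); split=> m; rewrite inE => hm /=;
  rewrite /torus_chart_val !asboolT // => v [? ?]; exact: hm.
Qed.

(** [extends_at A P Q]: the rational map defined by [A] is regular at [P] and
    takes the value [Q] there. *)
Definition extends_at (A : 'M[int]_n) (P Q : toric_variety D) : Prop :=
  exists (V : set (toric_variety D)) (psi : toric_variety D -> toric_variety D),
    [/\ V P, morphism_on V psi,
        forall t, V (of_torus t) -> psi (of_torus t) = of_torus (torus_map A t) &
        psi P = Q].

Definition defined_at (A : 'M[int]_n) (P : toric_variety D) : Prop :=
  exists Q, extends_at A P Q.

(** The value at [P] is only meaningful if [defined_at A P] holds. *)
Definition monomial_map (A : 'M[int]_n) (P : toric_variety D) :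
  toric_variety D := xget P [set Q | extends_at A P Q].

Definition forward_defined (A : 'M[int]_n) : set (toric_variety D) :=
  [set P | forall k, defined_at A (iter k (monomial_map A) P)].

End MonomialMap.

Definition arith_prog (a b : nat) : set nat :=
  [set m | exists k : nat, m = (a + b * k)%N].

Definition finite_union_of_arith_progs (S : set nat) : Prop :=
  exists l : seq (nat * nat), S = [set m | exists2 p, p \in l & arith_prog p.1 p.2 m].

(* Main.v *)
From Stdlib Require Import Relation_Operators.
Require Import Defs.
From mathcomp Require Import all_boot all_order all_algebra all_field.
From mathcomp Require Import generic_quotient complex zify ring.
From mathcomp Require Import boolp classical_sets cardinality reals topology.

Set Implicit Arguments.
Unset Strict Implicit.
Unset Printing Implicit Defensive.

Import Order.TTheory GRing.Theory Num.Theory.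

Local Open Scope classical_set_scope.
Local Open Scope ring_scope.

(** The proof reduces the statement to a torus, where it is a p-adic
    interpolation argument in the style of Skolem, Mahler and Lech.

    Toric part.  Every point lies in the chart of exactly one cone s in which
    its coordinates vanish precisely off s^perp ([exists_central]); such a
    reading of the point is called central.  If the monomial map of A is
    regular at P and takes the value Q, then pulling back the characters
    regular near Q, and using that characters of the torus are linearly
    independent, shows that A maps the cone s of P into the cone t of Q, and
    that Q(m) = P(mA) for all m in S_t ([extends_at_val]). The cone t is the
    one whose relative interior receives that of s, hence it is determined by s
    ([transition_unique], a consequence of Farkas' lemma). There are finitely
    many cones, so the sequence of cones along the orbit is eventually
    periodic.  Along a residue class of the period q the cone t is constant,
    and the coordinates of the l-th point are, on the lattice of all m
    orthogonal to t, products of powers y_j^((m B^l)_j) with B = A^q and fixed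
    nonzero complex numbers y_j; the other coordinates vanish.

    Arithmetic part ([monomial_orbit]). There is a modulus N, depending only on
    y and B, such that a sum of terms c * y^(m B^l), with l restricted to a
    residue class modulo N and beyond a fixed threshold, vanishes identically
    as soon as it has infinitely many zeros.  Since N serves all equations of Y
    at once, on each class the set in question is finite or everything, and the
    theorem follows.

    To obtain N one needs an odd prime p and a subring S of the complex numbers
    with no nonzero element infinitely divisible by p, which contains all y_j
    and 1/y_j and in which some power of each y_j is congruent to 1 modulo p
    ([separated_subring]). Take S = Z[y_j, 1/y_j, (y_j^N_j - 1)/p]. As it is
    noetherian, by Hilbert's basis theorem, it suffices that 1/p is not in S;
    and indeed a specialisation of Z[y_j, 1/y_j] to algebraic numbers extends
    to S with values in the ring of p-integral algebraic numbers, for all but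
    finitely many p and suitable N_j.  A power of B is congruent to 1 modulo p,
    and the sequences l |-> y^(m B^l), along a residue class, have i-th
    differences divisible by p^i.  Such a sequence with k zeros takes all its
    values in p^(k/2) S ([zero_estimate]), because its Newton interpolation
    polynomial is divisible by k linear factors and v_p(i!) <= i/2. The
    coefficients c, which need not lie in S, are dealt with by elimination
    ([analytic_zeros_span]). *)

(** * Subrings of a field *)

Section Subrings.
Variable F : numFieldType.

Definition is_subring (S : set F) : Prop :=
  [/\ S 1, forall a b, S a -> S b -> S (a - b) &
      forall a b, S a -> S b -> S (a * b)].

Section Closure.
Variables (S : set F) (hS : is_subring S).

Lemma subring1 : S 1. Proof. by case: hS. Qed.
Lemma subringB a b : S a -> S b -> S (a - b). Proof. by case: hS => _ + _; apply. Qed.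
Lemma subringM a b : S a -> S b -> S (a * b). Proof. by case: hS => _ _; apply. Qed.
Lemma subring0 : S 0. Proof. by rewrite -(subrr 1); apply: subringB subring1 subring1. Qed.
Lemma subringN a : S a -> S (- a).
Proof. by move=> h; rewrite -sub0r; apply: subringB subring0 h. Qed.
Lemma subringD a b : S a -> S b -> S (a + b).
Proof. by move=> ha hb; rewrite -(opprK b); apply: subringB ha (subringN hb). Qed.
Lemma subringX a k : S a -> S (a ^+ k).
Proof. by move=> ha; elim: k => [|k IH]; [exact: subring1 | rewrite exprS; exact: subringM]. Qed.
Lemma subring_sum (I : Type) (r : seq I) (P : pred I) (f : I -> F) :
  (forall i, P i -> S (f i)) -> S (\sum_(i <- r | P i) f i).
Proof. by move=> h; apply: big_ind => //; [exact: subring0 | exact: subringD]. Qed.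
Lemma subring_nat k : S k%:R.
Proof. by elim: k => [|k IH]; [exact: subring0 | rewrite mulrS; apply: subringD subring1 IH]. Qed.
Lemma subring_int (k : int) : S k%:~R.
Proof.
case: k => k; first exact: subring_nat.
by rewrite NegzE mulrNz; apply/subringN/subring_nat.
Qed.

Definition coefs_in (q : {poly F}) : Prop := forall i, S q`_i.

Lemma coefs_in0 : coefs_in 0. Proof. by move=> i; rewrite coef0; exact: subring0. Qed.
Lemma coefs_inC a : S a -> coefs_in a%:P.
Proof. by move=> h i; rewrite coefC; case: eqP => // _; exact: subring0. Qed.
Lemma coefs_inX : coefs_in 'X.
Proof. by move=> i; rewrite coefX; exact: subring_nat. Qed.
Lemma coefs_inB p q : coefs_in p -> coefs_in q -> coefs_in (p - q).
Proof. by move=> hp hq i; rewrite coefB; exact: subringB. Qed.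
Lemma coefs_inD p q : coefs_in p -> coefs_in q -> coefs_in (p + q).
Proof. by move=> hp hq i; rewrite coefD; exact: subringD. Qed.
Lemma coefs_inM p q : coefs_in p -> coefs_in q -> coefs_in (p * q).
Proof. by move=> hp hq i; rewrite coefM; apply: subring_sum => j _; exact: subringM. Qed.
Lemma coefs_inXn k : coefs_in 'X^k.
Proof. by move=> i; rewrite coefXn; exact: subring_nat. Qed.
Lemma coefs_inZ a p : S a -> coefs_in p -> coefs_in (a *: p).
Proof. by move=> ha hp i; rewrite coefZ; exact: subringM. Qed.
Definition adjoin (z : F) : set F := [set x | exists2 q, coefs_in q & x = q.[z]].

Lemma adjoin_subring z : is_subring (adjoin z).
Proof.
split.
- by exists 1; [apply: coefs_inC subring1 | rewrite hornerC].
- move=> _ _ [p hp ->] [q hq ->]; exists (p - q); first exact: coefs_inB.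
  by rewrite hornerD hornerN.
- move=> _ _ [p hp ->] [q hq ->]; exists (p * q); first exact: coefs_inM.
  by rewrite hornerM.
Qed.

Lemma adjoin_sub z : S `<=` adjoin z.
Proof. by move=> a ha; exists a%:P; [exact: coefs_inC | rewrite hornerC]. Qed.

Lemma adjoin_gen z : adjoin z z.
Proof. by exists 'X; [exact: coefs_inX | rewrite hornerX]. Qed.

End Closure.

Lemma adjoin_min (S T : set F) z : is_subring T -> S `<=` T -> T z ->
  adjoin S z `<=` T.
Proof.
move=> hT hST hz _ [q hq ->]; rewrite horner_coef.
apply: subring_sum => // i _; apply: subringM => //; first exact/hST/hq.
exact: subringX.
Qed.

Definition int_ring : set F := range (fun k : int => k%:~R : F).

Lemma int_subring : is_subring int_ring.
Proof.
split; first by exists 1.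
- by move=> _ _ [a _ <-] [b _ <-]; exists (a - b); rewrite // rmorphB.
- by move=> _ _ [a _ <-] [b _ <-]; exists (a * b); rewrite // rmorphM.
Qed.

Definition adjoins (zs : seq F) : set F :=
  foldr (fun z S => adjoin S z) int_ring zs.

Lemma adjoins_subring zs : is_subring (adjoins zs).
Proof. by elim: zs => [|z zs IH]; [exact: int_subring | exact: adjoin_subring]. Qed.

Lemma adjoins_mem zs z : z \in zs -> adjoins zs z.
Proof.
elim: zs => // a zs IH; rewrite inE => /orP[/eqP ->|h] /=.
  exact/adjoin_gen/adjoins_subring.
by apply: adjoin_sub; [exact: adjoins_subring | exact: IH].
Qed.

Lemma adjoins_min zs T : is_subring T -> (forall z, z \in zs -> T z) ->
  adjoins zs `<=` T.
Proof.
move=> hT; elim: zs => [_ _ [k _ <-]|z zs IH h]; first exact: subring_int.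
apply: adjoin_min => //; last by apply: h; rewrite mem_head.
by apply: IH => a ha; apply: h; rewrite inE ha orbT.
Qed.

(** * Noetherian subrings *)

Definition is_ideal (S I : set F) : Prop :=
  [/\ I `<=` S, I 0, forall a b, I a -> I b -> I (a + b) &
      forall s a, S s -> I a -> I (s * a)].

Definition lin_span (S : set F) (gs : seq F) : set F :=
  [set x | exists2 c : nat -> F, forall i, S (c i) &
           x = \sum_(i < size gs) c i * gs`_i].

Definition noetherian (S : set F) : Prop :=
  forall I, is_ideal S I ->
  exists2 gs : seq F, (forall g, g \in gs -> I g) & I `<=` lin_span S gs.

Lemma noetherian_int : noetherian int_ring.
Proof.
move=> I [hI h0 hD hM].
have hN a : I a -> I (- a).
  by move=> ha; rewrite -mulN1r; apply: hM => //; exists (- 1); rewrite // rmorphN1.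
have [h|h] := pselect (exists k : nat, (0 < k)%N /\ I k%:R); last first.
  exists [::] => // x Ix; have [k _ kE] := hI _ Ix.
  suff -> : x = 0 by exists (fun=> 0); [move=> _; exists 0 | rewrite big_ord0].
  apply: contrapT => /eqP x0; apply: h; exists `|k|%N.
  have k0 : k != 0 by apply: contraNneq x0 => k0; rewrite -kE k0.
  split; first by rewrite absz_gt0.
  case: k kE {k0} => k kE /=; first by rewrite pmulrn kE.
  by rewrite -(opprK k.+1%:R); apply: hN; rewrite pmulrn -mulrNz -NegzE kE.
have h' : exists k : nat, (0 < k)%N && `[< I k%:R >].
  by have [k [k0 Ik]] := h; exists k; rewrite k0; apply/asboolP.
case: (ex_minnP h') => d /andP[d0 /asboolP Id] dmin.
exists [:: d%:R]; first by move=> g; rewrite inE => /eqP ->.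
move=> x Ix; have [k _ kE] := hI _ Ix.
exists (fun=> (divz k d)%:~R); first by move=> _; exists (divz k d).
rewrite big_ord1 /=.
have Ir : I ((modz k d)%:~R).
  rewrite /modz rmorphB /= kE rmorphM /=; apply: hD => //.
  by apply: hN; apply: hM => //; exists (divz k d).
have dz0 : (d%:Z != 0) by rewrite -lt0n.
have := modz_ge0 k dz0.
case E : (modz k d) Ir => [r|//] Ir _.
have [r0|r0] := posnP r.
  by rewrite -kE {1}(divz_eq k d) E r0 addr0 rmorphM.
have := dmin r; rewrite r0 (asboolT Ir) => /(_ isT) dr.
have : (modz k d < d)%R by apply: ltz_pmod.
by rewrite E ltz_nat ltnNge dr.
Qed.

Lemma lin_span_sub (S I : set F) gs : is_subring S -> is_ideal S I ->
  (forall g, g \in gs -> I g) -> lin_span S gs `<=` I.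
Proof.
move=> hS [_ I0 ID IM] hg _ [c hc ->].
apply: big_ind => // i _; apply: IM => //; apply: hg; exact: mem_nth.
Qed.

(** Hilbert's basis theorem.  An ideal of S[z] is pulled back to an ideal I of
    polynomials with coefficients in S; the coefficients in degree d of the
    elements of I of degree at most d form an increasing sequence L d of ideals
    of S. Their union is finitely generated, hence equal to some L D, and lifts
    of generators of L 0, ..., L D generate I. *)
Lemma noetherian_adjoin (S : set F) z :
  is_subring S -> noetherian S -> noetherian (adjoin S z).
Proof.
move=> hS nS J [hJ J0 JD JM].
have hA := adjoin_subring hS z.
pose I := [set q | coefs_in S q /\ J q.[z]].
have I0 : I 0 by split; [exact: coefs_in0 | rewrite horner0].
have ID p q : I p -> I q -> I (p + q).
  by move=> [p1 p2] [q1 q2]; split; [exact: coefs_inD | rewrite hornerD; exact: JD].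
have IM p q : coefs_in S p -> I q -> I (p * q).
  move=> hp [q1 q2]; split; first exact: coefs_inM.
  by rewrite hornerM; apply: JM => //; exists p.
have IZ a q : S a -> I q -> I (a *: q).
  by move=> ha Iq; rewrite -mul_polyC; apply: IM => //; exact: coefs_inC.
have Isum (T : Type) (r : seq T) (f : T -> {poly F}) :
    (forall i, I (f i)) -> I (\sum_(i <- r) f i).
  by move=> h; apply: big_ind.
pose L d := [set a | exists2 q, I q /\ (size q <= d.+1)%N & a = q`_d].
have LI d : is_ideal S (L d).
  split.
  - by move=> _ [q [[hq _] _] ->]; exact: hq.
  - by exists 0; [rewrite size_poly0 | rewrite coef0].
  - move=> _ _ [p [Ip sp] ->] [q [Iq sq] ->]; exists (p + q); last by rewrite coefD.
    by split; [exact: ID | rewrite (leq_trans (size_polyD _ _)) // geq_max sp sq].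
  - move=> s _ hs [q [Iq sq] ->]; exists (s *: q); last by rewrite coefZ.
    by split; [exact: IZ | rewrite (leq_trans (size_scale_leq _ _))].
pose LL := [set a | exists d, L d a].
have Lmono d e : (d <= e)%N -> L d `<=` L e.
  move=> de _ [q [Iq sq] ->]; exists ('X^(e - d) * q).
    split; first by apply: IM => //; exact: coefs_inXn.
    have [->|q0] := eqVneq q 0; first by rewrite mulr0 size_poly0.
    by rewrite mulrC size_mulXn // -{2}(subnK de) -addnS leq_add2l.
  by rewrite coefXnM ltnNge leq_subr /= subKn.
have LLI : is_ideal S LL.
  split.
  - by move=> a [d]; case: (LI d) => + _ _ _; apply.
  - by exists 0%N; case: (LI 0%N).
  - move=> a b [d ha] [e hb]; exists (maxn d e).
    by case: (LI (maxn d e)) => _ _ + _; apply; apply: Lmono; [exact: leq_maxl| |exact: leq_maxr|].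
  - by move=> s a hs [d ha]; exists d; case: (LI d) => _ _ _; apply.
have Lgens d : exists Q : seq {poly F},
    [/\ forall q, q \in Q -> I q, forall q, q \in Q -> (size q <= d.+1)%N &
     L d `<=` lin_span S [seq q`_d | q : {poly F} <- Q]].
  have [gs gL Lg] := nS _ (LI d).
  have /choice[f fP] : forall g, exists q, g \in gs ->
      [/\ I q, (size q <= d.+1)%N & g = q`_d].
    move=> g; have [/gL [q [Iq sq] ->]|//] := boolP (g \in gs); first by exists q.
    by exists 0.
  exists [seq f g | g <- gs]; split.
  - by move=> _ /mapP[g /fP[+ _ _] ->].
  - by move=> _ /mapP[g /fP[_ + _] ->].
  rewrite -map_comp map_id_in // => g /fP[_ _ gE]; exact/esym.
have [gs gL Lg] := nS _ LLI.
have [D hD] : exists D, forall g, g \in gs -> L D g.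
  elim: gs gL {Lg} => [|g gs IH] gL; first by exists 0%N.
  have [|D hD] := IH; first by move=> x xs; apply: gL; rewrite inE xs orbT.
  have [d hd] := gL _ (mem_head _ _).
  exists (maxn d D) => x; rewrite inE => /orP[/eqP ->|/hD].
    by apply: Lmono hd; exact: leq_maxl.
  by apply: Lmono; exact: leq_maxr.
(* The sequence L is stationary from D on. *)
have LD d : (D <= d)%N -> L d `<=` L D.
  move=> _ a ha; have {ha} : LL a by exists d.
  by move/Lg; apply: lin_span_sub.
have /choice[G GP] := Lgens.
pose GG := flatten [seq G d | d <- iota 0 D.+1].
have GGI q : q \in GG -> I q.
  by move=> /flattenP[_ /mapP[d _ ->]]; case: (GP d) => + _ _; apply.
pose J' := [set x | exists2 c : nat -> F, forall i, adjoin S z (c i) &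
  x = \sum_(i < size GG) c i * (GG`_i).[z]].
have J'0 : J' 0.
  exists (fun=> 0); first by move=> _; exact: subring0.
  by rewrite big1 // => i _; rewrite mul0r.
have J'D a b : J' a -> J' b -> J' (a + b).
  move=> [c hc ->] [e he ->]; exists (fun i => c i + e i).
    by move=> i; exact: subringD.
  by rewrite -big_split; apply: eq_bigr => i _; rewrite /= mulrDl.
have J'M s a : adjoin S z s -> J' a -> J' (s * a).
  move=> hs [c hc ->]; exists (fun i => s * c i).
    by move=> i; exact: subringM.
  by rewrite mulr_sumr; apply: eq_bigr => i _; rewrite mulrA.
have J'g q : q \in GG -> J' q.[z].
  move=> hq; exists (fun i => (i == index q GG)%:R).
    by move=> i; exact: subring_nat.
  have hi : (index q GG < size GG)%N by rewrite index_mem.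
  rewrite (bigD1 (Ordinal hi)) //= eqxx mul1r nth_index // big1 ?addr0 // => i.
  by rewrite -val_eqE /= => /negbTE ->; rewrite mul0r.
exists [seq q.[z] | q : {poly F} <- GG].
  by move=> _ /mapP[q /GGI[_ h] ->].
have key m : forall q : {poly F}, (size q <= m)%N -> I q -> J' q.[z].
  elim: m => [|d IH] q.
    by rewrite leqn0 size_poly_eq0 => /eqP -> _; rewrite horner0.
  move=> sq Iq.
  have : L (minn d D) q`_d.
    have : L d q`_d by exists q.
    by rewrite /minn; case: ltnP => // /LD; apply.
  case: (GP (minn d D)) => GI Gs GL /GL [c hc cE].
  rewrite size_map in cE.
  (* Above degree D the leading coefficient already occurs in degree D. *)
  pose e := minn d D; pose r := \sum_(i < size (G e)) c i *: (G e)`_i.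
  have eD : (e <= D)%N by exact: geq_minr.
  have ed : (e <= d)%N by exact: geq_minl.
  have sr : (size ('X^(d - e) * r)%R <= d.+1)%N.
    have [->|r0] := eqVneq r 0; first by rewrite mulr0 size_poly0.
    rewrite mulrC size_mulXn // -{2}(subnK ed) -addnS leq_add2l.
    apply: (leq_trans (size_sum _ _ _)); apply/bigmax_leqP => i _.
    by rewrite (leq_trans (size_scale_leq _ _)) // Gs // mem_nth.
  have rI : I r.
    apply: Isum => i; apply: IZ => //.
    by apply: GI; exact: mem_nth.
  have rJ : J' r.[z].
    rewrite horner_sum; apply: big_ind => // i _; rewrite hornerZ.
    apply: J'M; first exact: adjoin_sub.
    apply/J'g/flattenP; exists (G e); last exact: mem_nth.
    by apply: map_f; rewrite mem_iota.
  have <- : (q - 'X^(d - e) * r) + 'X^(d - e) * r = q by rewrite subrK.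
  rewrite hornerD; apply: J'D; last first.
    rewrite hornerM; apply: J'M => //; exists 'X^(d - e) => //; exact: coefs_inXn.
  apply: IH; last first.
    apply: ID => //; rewrite -mulNr; apply: IM => //.
    by rewrite -sub0r; apply: coefs_inB => //; [exact: coefs_in0 | exact: coefs_inXn].
  apply/leq_sizeP => j; rewrite leq_eqVlt => /orP[/eqP <-|dj].
    rewrite coefB coefXnM ltnNge leq_subr /= subKn // cE /r coef_sum.
    apply/eqP; rewrite subr_eq0; apply/eqP.
    apply: eq_bigr => i _; rewrite coefZ; congr (_ * _).
    by rewrite (nth_map 0).
  rewrite coefB !(leq_sizeP _ d.+1 _) ?subrr //.
move=> x Jx; have [q hq xE] := hJ _ Jx.
have [|c hc E] := key (size q) q (leqnn _); first by split; rewrite -?xE.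
exists c => //; rewrite xE E size_map; apply: eq_bigr => i _.
by rewrite (nth_map 0).
Qed.

Lemma noetherian_adjoins zs : noetherian (adjoins zs).
Proof.
elim: zs => [|z zs IH]; first exact: noetherian_int.
exact/noetherian_adjoin/IH/adjoins_subring.
Qed.

(** The principal ideals generated by the x / a^k increase; once the sequence
    is stationary, x / a^(k+1) = c x / a^k with c in S, so that c is the
    inverse of a. *)
Lemma noetherian_separated (S : set F) (a x : F) :
  is_subring S -> noetherian S -> S a -> a != 0 -> x != 0 ->
  (forall k, S (x / a ^+ k)) -> S a^-1.
Proof.
move=> hS nS Sa a0 x0 hx.
pose I := [set y | exists k, S (y / (x / a ^+ k))].
have b0 k : x / a ^+ k != 0 by rewrite mulf_neq0 ?invr_eq0 ?expf_neq0.
have Imono y k l : (k <= l)%N -> S (y / (x / a ^+ k)) -> S (y / (x / a ^+ l)).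
  move=> kl h; rewrite -(subnK kl) exprD.
  have -> : y / (x / (a ^+ (l - k) * a ^+ k)) = a ^+ (l - k) * (y / (x / a ^+ k)).
    by rewrite !invf_div -mulrA mulrCA.
  by apply: subringM => //; exact: subringX.
have II : is_ideal S I.
  split.
  - move=> y [k h]; rewrite -[y](divfK (b0 k)); exact: subringM.
  - by exists 0%N; rewrite mul0r; exact: subring0.
  - move=> y y' [k h] [l h']; exists (maxn k l); rewrite mulrDl.
    by apply: subringD => //; apply: Imono; [exact: leq_maxl| |exact: leq_maxr|].
  - by move=> s y hs [k h]; exists k; rewrite -mulrA; exact: subringM.
have [gs gI Ig] := nS _ II.
have [k hk] : exists k, forall g, g \in gs -> S (g / (x / a ^+ k)).
  elim: gs gI {Ig} => [|g gs IH] gI; first by exists 0%N.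
  have [|k hk] := IH; first by move=> y ys; apply: gI; rewrite inE ys orbT.
  have [l hl] := gI _ (mem_head _ _).
  exists (maxn l k) => y; rewrite inE => /orP[/eqP ->|/hk].
    by apply: Imono hl; exact: leq_maxl.
  by apply: Imono; exact: leq_maxr.
have [c hc cE] : lin_span S gs (x / a ^+ k.+1).
  by apply: Ig; exists k.+1; rewrite divff //; exact: subring1.
have : S (x / a ^+ k.+1 / (x / a ^+ k)).
  rewrite cE mulr_suml; apply: subring_sum => // i _; rewrite -mulrA.
  by apply: subringM => //; apply: hk; exact: mem_nth.
congr S; rewrite invf_div exprSr invfM (mulrA x) mulrAC.
by rewrite -[x / a ^+ k]invf_div mulVf ?mul1r // mulf_neq0 ?invr_eq0 ?expf_neq0.
Qed.

End Subrings.

(** * Specialisation to algebraic numbers *)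

Section Specialisation.
Variable F : numFieldType.

(** Ring homomorphisms are total functions constrained on S only, so that
    subrings can vary without a change of type. *)
Definition hom_on (S : set F) (h : F -> algC) : Prop :=
  [/\ h 1 = 1, forall a b, S a -> S b -> h (a - b) = h a - h b &
      forall a b, S a -> S b -> h (a * b) = h a * h b].

Section Hom.
Variables (S : set F) (hS : is_subring S) (h : F -> algC) (hh : hom_on S h).

Lemma hom1 : h 1 = 1. Proof. by case: hh. Qed.
Lemma homB a b : S a -> S b -> h (a - b) = h a - h b.
Proof. by case: hh => _ + _; apply. Qed.
Lemma homM a b : S a -> S b -> h (a * b) = h a * h b.
Proof. by case: hh => _ _; apply. Qed.
Lemma hom0 : h 0 = 0.
Proof. by rewrite -(subrr 1) homB ?subrr //; exact: subring1. Qed.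
Lemma homN a : S a -> h (- a) = - h a.
Proof. by move=> ha; rewrite -sub0r homB ?hom0 ?sub0r //; exact: subring0. Qed.
Lemma homD a b : S a -> S b -> h (a + b) = h a + h b.
Proof.
by move=> ha hb; rewrite -{1}(opprK b) homB ?homN ?opprK //; exact: subringN.
Qed.
Lemma homX a k : S a -> h (a ^+ k) = h a ^+ k.
Proof.
move=> ha; elim: k => [|k IH]; first exact: hom1.
by rewrite !exprS homM ?IH //; exact: subringX.
Qed.
Lemma hom_nat k : h k%:R = k%:R.
Proof.
elim: k => [|k IH]; first exact: hom0.
by rewrite !mulrS homD ?hom1 ?IH //; [exact: subring1 | exact: subring_nat].
Qed.
Lemma hom_sum n (f : 'I_n -> F) : (forall i, S (f i)) ->
  h (\sum_i f i) = \sum_i h (f i).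
Proof.
move=> Sf; elim: n f Sf => [|n IH] f Sf; first by rewrite !big_ord0 hom0.
rewrite !big_ord_recl homD ?IH //; exact: subring_sum.
Qed.

Lemma coef_hom q i : (map_poly h q)`_i = h q`_i.
Proof. exact: coef_map_id0 hom0. Qed.

Lemma map_homB p q : coefs_in S p -> coefs_in S q ->
  map_poly h (p - q) = map_poly h p - map_poly h q.
Proof. by move=> hp hq; apply/polyP => i; rewrite coefB !coef_hom coefB homB. Qed.

Lemma map_homM p q : coefs_in S p -> coefs_in S q ->
  map_poly h (p * q) = map_poly h p * map_poly h q.
Proof.
move=> hp hq; apply/polyP => i; rewrite coefM coef_hom coefM hom_sum => [|j].
  by apply: eq_bigr => j _; rewrite !coef_hom homM.
exact: subringM.
Qed.

Lemma map_homC a : map_poly h a%:P = (h a)%:P.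
Proof. by apply/polyP => i; rewrite coef_hom !coefC; case: eqP; rewrite ?hom0. Qed.

(** The homomorphism extending h and sending z to zeta; the hypothesis says
    that the value at zeta does not depend on the polynomial chosen to
    represent an element of S[z]. *)
Lemma hom_extend z zeta :
  (forall q, coefs_in S q -> q.[z] = 0 -> (map_poly h q).[zeta] = 0) ->
  exists2 h', hom_on (adjoin S z) h' &
    forall q, coefs_in S q -> h' q.[z] = (map_poly h q).[zeta].
Proof.
move=> hz.
have /choice[g gP] : forall x, exists q, adjoin S z x -> coefs_in S q /\ x = q.[z].
  by move=> x; have [[q hq xE]|?] := pselect (adjoin S z x); [exists q | exists 0].
pose h' x := (map_poly h (g x)).[zeta].
have h'E q : coefs_in S q -> h' q.[z] = (map_poly h q).[zeta].
  move=> hq; have [go gE] : coefs_in S (g q.[z]) /\ q.[z] = (g q.[z]).[z].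
    by apply: gP; exists q.
  apply/eqP; rewrite -subr_eq0 /h' -hornerN -hornerD -map_homB //.
  by rewrite hz //; [exact: coefs_inB | rewrite hornerD hornerN -gE subrr].
exists h' => //; split.
- have := h'E 1%:P (coefs_inC hS (subring1 hS)).
  by rewrite map_homC !hornerC hom1.
- move=> _ _ [p hp ->] [q hq ->]; rewrite -hornerN -hornerD !h'E ?map_homB //.
    by rewrite hornerD hornerN.
  exact: coefs_inB.
- move=> _ _ [p hp ->] [q hq ->]; rewrite -hornerM !h'E ?map_homM ?hornerM //.
  exact: coefs_inM.
Qed.

End Hom.

(** Asking that a given nonzero w survive makes the property pass from S to
    S[z]: the leading coefficient of the equation of z over S must not be
    killed, otherwise the equation may lose its roots. *)
Definition specialisable (S : set F) : Prop :=
  forall w, S w -> w != 0 -> exists2 h, hom_on S h & h w != 0.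

Lemma specialisable_int : specialisable (@int_ring F).
Proof.
move=> _ [k _ <-] k0.
have inj := @intr_inj F.
have /choice[g gP] : forall x : F, exists k : int, @int_ring F x -> k%:~R = x.
  by move=> x; have [[l _ lE]|?] := pselect (@int_ring F x); [exists l | exists 0].
have gE l : g l%:~R = l by apply/inj/gP; exists l.
exists (fun x => (g x)%:~R); last first.
  by rewrite gE intr_eq0; move: k0; rewrite intr_eq0.
split; first by have /= -> := gE 1.
- by move=> _ _ [a _ <-] [b _ <-]; rewrite -rmorphB !gE rmorphB.
- by move=> _ _ [a _ <-] [b _ <-]; rewrite -rmorphM !gE rmorphM.
Qed.

(** Division by T inside S[X]: multiplying by a power of the leading
    coefficient of T makes up for the missing inverses. *)
Lemma pseudo_division (S : set F) (P T : {poly F}) : is_subring S ->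
  coefs_in S P -> coefs_in S T -> T != 0 ->
  exists k Q R, [/\ coefs_in S Q, coefs_in S R, (size R < size T)%N &
    lead_coef T ^+ k *: P = T * Q + R].
Proof.
move=> hS hP hT T0.
elim: {P}(size P) {-2}P (leqnn (size P)) hP => [|m IH] P sP hP.
  exists 0%N, 0, 0; split; [exact: coefs_in0|exact: coefs_in0| |].
    by rewrite size_poly0 size_poly_gt0.
  by move: sP; rewrite leqn0 size_poly_eq0 => /eqP ->; rewrite mulr0 addr0 scaler0.
have [sPT|sTP] := ltnP (size P) (size T).
  exists 0%N, 0, P; split => //; first exact: coefs_in0.
  by rewrite expr0 scale1r mulr0 add0r.
set a := lead_coef T.
have Sa : S a by rewrite /a lead_coefE.
pose M := P`_m *: 'X^(size P - size T) : {poly F}.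
have [sPm|] := ltnP (size P) m.+1; first exact: (IH P).
move=> sPm; have {sPm} sPm : size P = m.+1 by apply/eqP; rewrite eqn_leq sP.
have oM : coefs_in S M by apply: coefs_inZ => //; exact: coefs_inXn.
have [k [Q [R [hQ hR sR E]]]] : exists k Q R, [/\ coefs_in S Q, coefs_in S R, (size R < size T)%N &
    a ^+ k *: (a *: P - T * M) = T * Q + R].
  apply: IH; last by apply: coefs_inB => //; [exact: coefs_inZ | exact: coefs_inM].
  have aux (s x y : nat) : (s <= y)%N -> (y <= x)%N -> (s <= x - (y - s))%N by lia.
  have T1 : (0 < size T)%N by rewrite size_poly_gt0.
  apply/leq_sizeP => j mj; rewrite coefB coefZ /M -scalerAr coefZ coefMXn sPm.
  rewrite sPm in sTP.
  have -> : (j < m.+1 - size T)%N = false by lia.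
  move: mj; rewrite leq_eqVlt => /orP[/eqP <-|mj].
    have -> : (m - (m.+1 - size T) = (size T).-1)%N by lia.
    by rewrite -lead_coefE mulrC subrr.
  have -> : P`_j = 0 by rewrite nth_default ?sPm.
  have -> : T`_(j - (m.+1 - size T)) = 0. rewrite nth_default //; exact: aux.
  by rewrite !mulr0 subrr.
exists k.+1, (Q + a ^+ k *: M), R; split => //.
  by apply: coefs_inD => //; apply: coefs_inZ => //; exact: subringX.
rewrite mulrDr -scalerAr addrAC -E scalerBr subrK exprSr scalerA //.
Qed.

(** The Euclidean algorithm on P and a polynomial W with W(z) = w, run with
    pseudo-division: by minimality of P the remainders do not vanish at z, so
    the last one is a nonzero constant b, a multiple of w.  A homomorphism that
    does not kill b does not kill w. *)
Lemma bezout_value (S : set F) (P : {poly F}) z w : is_subring S ->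
  coefs_in S P -> P != 0 -> P.[z] = 0 ->
  (forall q, coefs_in S q -> q.[z] = 0 -> (size q < size P)%N -> q = 0) ->
  adjoin S z w -> w != 0 ->
  exists b U, [/\ S b, b != 0, coefs_in S U & b = U.[z] * w].
Proof.
move=> hS oP P0 Pz Pmin [W oW wE] w0.
suff key m : forall T U : {poly F}, (size T <= m)%N -> coefs_in S T -> coefs_in S U -> T != 0 ->
    (size T < size P)%N -> T.[z] = U.[z] * w ->
    exists b U, [/\ S b, b != 0, coefs_in S U & b = U.[z] * w].
  have [k [Q [R [hQ hR sR E]]]] := pseudo_division hS oW oP P0.
  have Rz : R.[z] = (lead_coef P ^+ k)%:P.[z] * w.
    have := congr1 (horner^~ z) E.
    by rewrite hornerZ hornerD hornerM Pz mul0r add0r -wE hornerC => <-.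
  apply: (key _ _ _ (leqnn _) hR _ _ sR Rz).
    by apply: coefs_inC => //; apply: subringX => //; rewrite lead_coefE.
  apply: contraTneq isT => R0; move/esym/eqP: Rz; rewrite R0 horner0 hornerC.
  by rewrite mulf_eq0 (negbTE w0) orbF expf_eq0 lead_coef_eq0 (negbTE P0) andbF.
elim: m => [|m IH] T U sT oT oU T0 sTP Tz.
  by move: sT; rewrite leqn0 size_poly_eq0 (negbTE T0).
have [/eqP/size_poly1P[c c0 TE]|sT1] := eqVneq (size T) 1%N.
  exists c, U; split => //; first by have := oT 0%N; rewrite TE coefC.
  by rewrite -Tz TE hornerC.
have T1 : (0 < size T)%N by rewrite size_poly_gt0.
have [k [Q [R [hQ hR sR E]]]] := pseudo_division hS oP oT T0.
have Rz : R.[z] = (- Q * U).[z] * w.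
  have /eqP := congr1 (horner^~ z) E.
  rewrite hornerZ hornerD hornerM Pz mulr0 eq_sym addr_eq0 Tz => /eqP E'.
  by rewrite -[R.[z]]opprK -E' hornerM hornerN; ring.
apply: (IH R (- Q * U)) => //.
- by rewrite -ltnS (leq_trans sR).
- by apply: coefs_inM => //; rewrite -sub0r; apply: coefs_inB => //; exact: coefs_in0.
- apply: contraTneq isT => R0.
  have kP0 : lead_coef T ^+ k *: P != 0.
    by rewrite scaler_eq0 (negbTE P0) orbF expf_eq0 lead_coef_eq0 (negbTE T0) andbF.
  move: E; rewrite R0 addr0 => E.
  have Q0 : Q != 0 by apply: contraNneq kP0 => Q0; rewrite E Q0 mulr0.
  have sE : size P = (size T + size Q).-1.
    rewrite -size_mul // -E size_scale // expf_eq0 lead_coef_eq0 (negbTE T0) andbF //.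
  have Q1 : (0 < size Q)%N by rewrite size_poly_gt0.
  have /eqP : (T * Q).[z] = 0 by rewrite -E hornerZ Pz mulr0.
  rewrite hornerM mulf_eq0 => /orP[] /eqP h.
    by move/eqP: T0; case; apply: Pmin.
  by move/eqP: Q0; case; apply: Pmin => //; lia.
- by rewrite (ltn_trans sR).
Qed.

(** If z is transcendental over S, the value of z may be chosen outside the
    finitely many roots of the image of W. If z is algebraic, with minimal
    polynomial P, then once the leading coefficient of P is not killed every
    relation over S satisfied by z is satisfied by any root of the image of P. *)
Lemma specialisable_adjoin (S : set F) z :
  is_subring S -> specialisable S -> specialisable (adjoin S z).
Proof.
move=> hS sS w hw w0.
have [[P0 [oP0 nP0 P0z]]|tr] := pselect (exists P, [/\ coefs_in S P, P != 0 & P.[z] = 0]).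
- have ex : exists n, `[< exists P, [/\ coefs_in S P, P != 0, P.[z] = 0 & size P = n] >].
    by exists (size P0); apply/asboolP; exists P0.
  case: (ex_minnP ex) => n /asboolP[P [oP nP Pz sP]] nmin.
  have Pmin q : coefs_in S q -> q.[z] = 0 -> (size q < size P)%N -> q = 0.
    move=> oq qz sq; apply: contrapT => /eqP q0.
    have := nmin (size q); rewrite leqNgt -sP sq => /(_ _)/negP[] //.
    by apply/asboolP; exists q.
  have [b [U [Sb b0 oU bE]]] := bezout_value hS oP nP Pz Pmin hw w0.
  have Sa : S (lead_coef P) by rewrite lead_coefE.
  have [||h hh] := sS (lead_coef P * b).
  + exact: subringM.
  + by rewrite mulf_neq0 // lead_coef_eq0.
  rewrite (homM hh) // mulf_eq0 negb_or => /andP[ha hb].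
  have sP1 : (1 < size P)%N.
    rewrite ltn_neqAle size_poly_gt0 nP andbT eq_sym.
    apply/negP => /size_poly1P[c c0 PE]; move/eqP: c0; case.
    by rewrite -Pz PE hornerC.
  have sh : size (map_poly h P) = size P.
    by apply: size_map_poly_id0.
  have [|zeta /eqP hz] := closed_rootP (map_poly h P) _.
    by rewrite sh; apply: contraTneq sP1 => ->.
  have [|h' hh' h'E] := hom_extend hS hh (z := z) (zeta := zeta).
    move=> q oq qz; have [k [Q [R [oQ oR sR E]]]] := pseudo_division hS oq oP nP.
    have R0 : R = 0.
      apply: Pmin => //; have := congr1 (horner^~ z) E.
      by rewrite hornerZ hornerD hornerM Pz qz mulr0 mul0r add0r.
    have := congr1 (fun p => (map_poly h p).[zeta]) E.
    rewrite R0 addr0 (map_homM hS hh) // hornerM.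
    rewrite hz mul0r -mul_polyC.
    rewrite (map_homM hS hh) ?(map_homC hS hh) //; last first.
      by apply: coefs_inC => //; exact: subringX.
    rewrite hornerM hornerC (homX hS hh) // => /eqP.
    by rewrite mulf_eq0 expf_eq0 (negbTE ha) andbF => /eqP.
  exists h' => //; apply: contraNneq hb => hw0.
  have <- : h' b = h b.
    by have := h'E _ (coefs_inC hS Sb); rewrite (map_homC hS hh) !hornerC.
  rewrite bE (homM hh') //; last by exists U.
  by rewrite hw0 mulr0.
- case: hw w0 => W oW ->{w} w0.
  have W0 : W != 0 by apply: contraNneq w0 => ->; rewrite horner0.
  have [||h hh ha] := sS (lead_coef W).
  + by rewrite lead_coefE.
  + by rewrite lead_coef_eq0.
  have hW0 : map_poly h W != 0.
    by rewrite -size_poly_gt0 size_map_poly_id0 ?size_poly_gt0.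
  have [zeta hz] : exists zeta, (map_poly h W).[zeta] != 0.
    apply: contrapT => no.
    have aR : all (root (map_poly h W)) [seq i%:R | i <- iota 0 (size (map_poly h W))].
      by apply/allP => x _; apply: contrapT => hx; apply: no; exists x; apply/negP.
    have uR : uniq [seq i%:R : algC | i <- iota 0 (size (map_poly h W))].
      by rewrite map_inj_uniq ?iota_uniq // => a b /eqP; rewrite eqr_nat => /eqP.
    by have := max_poly_roots hW0 aR uR; rewrite size_map size_iota ltnn.
  have [|h' hh' h'E] := hom_extend hS hh (z := z) (zeta := zeta).
    move=> q oq qz; suff -> : q = 0 by rewrite map_poly0 horner0.
    by apply: contrapT => /eqP q0; apply: tr; exists q.
  by exists h' => //; rewrite h'E.
Qed.

Lemma specialisable_adjoins zs : specialisable (adjoins zs).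
Proof.
elim: zs => [|z zs IH]; first exact: specialisable_int.
exact/specialisable_adjoin/IH/adjoins_subring.
Qed.

End Specialisation.

(** * Algebraic numbers at a prime *)

Lemma pigeonhole (T : finType) (f : nat -> T) : exists i j, (i < j)%N /\ f i = f j.
Proof.
apply: contrapT => no.
have inj : injective (fun i : 'I_(#|T|.+1) => f i).
  move=> i j fij; apply/val_inj/eqP; have [ij|ij|] := ssrnat.ltngtP (val i) (val j) => //.
    by case: no; exists i, j.
  by case: no; exists j, i; split => //; exact/esym.
by have := leq_card _ inj; rewrite card_ord ltnn.
Qed.

Section PLocal.
Variable p : nat.
Hypothesis p_pr : prime p.

(** The algebraic numbers integral at all places above p. *)
Definition p_integral : set algC :=
  [set w | exists2 D : nat, ~~ (p %| D)%N & D%:R * w \in Aint].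

Lemma p_integral_subring : is_subring p_integral.
Proof.
split.
- exists 1%N; last by rewrite mulr1 Aint1.
  by rewrite dvdn1 neq_ltn prime_gt1 ?orbT.
- move=> a b [D hD ha] [E hE hb]; exists (D * E)%N.
    by rewrite Euclid_dvdM // negb_or hD hE.
  rewrite natrM mulrBr [X in X - _]mulrAC -[X in _ - X]mulrA.
  by rewrite rpredB // rpredM // rpred_nat.
- move=> a b [D hD ha] [E hE hb]; exists (D * E)%N.
    by rewrite Euclid_dvdM // negb_or hD hE.
  by rewrite natrM mulrACA rpredM.
Qed.

(** If D / p is an algebraic integer, then it is an integer, since it is
    rational. *)
Lemma p_integral_inv : ~ p_integral p%:R^-1.
Proof.
move=> [D /negP hD hA]; apply: hD.
have /Cint_rat_Aint/(_ hA) : D%:R / p%:R \in Crat.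
  by rewrite rpredM ?rpredV ?Crat_rat // rpred_nat.
move=> /intrP[m mE]; have p0 : p%:R != 0 :> algC by rewrite pnatr_eq0 -lt0n prime_gt0.
have /eqP : D%:R = m%:~R * p%:R :> algC by rewrite -mE divfK.
rewrite -[p%:R]/((p%:Z)%:~R) -[D%:R]/((D%:Z)%:~R) -intrM eqr_int => /eqP E.
by have := dvdz_mull m (dvdzz p%:Z); rewrite -E.
Qed.

Lemma intr_Fp_eq0 (k : int) : (k%:~R == 0 :> 'F_p) = (p %| k)%Z.
Proof. by rewrite (dvdz_pcharf (pchar_Fp p_pr)). Qed.

Lemma lift_Fp (Q : {poly 'F_p}) : exists Q' : {poly int}, map_poly intr Q' = Q.
Proof.
exists (\poly_(i < size Q) (val Q`_i : int)); apply/polyP => i.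
rewrite coef_map coef_poly; case: ltnP => h.
  by rewrite -[LHS]/((val Q`_i)%:R) natr_Zp.
by rewrite nth_default.
Qed.

(** The powers of X take finitely many values in F_p[X] / (P), so that P
    divides some X^j - X^i modulo p; evaluate at eta a lift of this
    divisibility to the integers. *)
Lemma torsion_mod_p (P : {poly int}) (eta : algC) :
  root (map_poly intr P) eta -> map_poly intr P != 0 :> {poly 'F_p} ->
  p_integral eta -> p_integral eta^-1 -> eta != 0 ->
  exists2 N, (0 < N)%N & p_integral ((eta ^+ N - 1) / p%:R).
Proof.
move=> Peta P0 heta hetaV eta0.
have hO := p_integral_subring.
pose Pb : {poly 'F_p} := map_poly intr P.
have [i [j [ij /(congr1 rVpoly) E]]] :=
  pigeonhole (fun k => poly_rV ('X^k %% Pb) : 'rV['F_p]_(size Pb)).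
have sm k : (size ('X^k %% Pb)%R <= size Pb)%N by rewrite ltnW // ltn_modp.
move: E; rewrite /= (poly_rV_K (sm i)) (poly_rV_K (sm j)) => E.
have dv : Pb %| 'X^j - 'X^i by rewrite /dvdp modpD modpN E subrr.
have [Q QE] := lift_Fp (('X^j - 'X^i) %/ Pb).
have [R RE] : exists R : {poly int}, 'X^j - 'X^i = Q * P + p%:Z *: R.
  exists (\poly_(k < size ('X^j - 'X^i - Q * P)) (divz ('X^j - 'X^i - Q * P)`_k p%:Z)).
  apply/polyP => k; rewrite [RHS]coefD coefZ coef_poly -[LHS](subrK (Q * P)`_k) [RHS]addrC.
  congr (_ + _); rewrite -coefB; case: ltnP => h; last by rewrite nth_default ?mulr0.
  rewrite [RHS]mulrC divzK // -intr_Fp_eq0 -coef_map rmorphB /= rmorphB /= !map_polyXn.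
  by rewrite rmorphM /= QE divpK // subrr coef0.
exists (j - i)%N; first by rewrite subn_gt0.
have oR : p_integral (map_poly intr R).[eta].
  rewrite horner_coef; apply: subring_sum => // k _; apply: subringM => //.
    by rewrite coef_map; exact: subring_int.
  exact: subringX.
have p0 : p%:R != 0 :> algC by rewrite pnatr_eq0 -lt0n prime_gt0.
suff -> : (eta ^+ (j - i) - 1) / p%:R = eta^-1 ^+ i * (map_poly intr R).[eta].
  by apply: subringM => //; exact: subringX.
have : eta ^+ j - eta ^+ i = p%:R * (map_poly intr R).[eta].
  have := congr1 (fun q => (map_poly (intr : int -> algC) q).[eta]) RE.
  rewrite !(rmorphB, rmorphD, rmorphM) /= !map_polyXn map_polyZ /= !hornerE /=.
  by move: Peta; rewrite rootE => /eqP ->; rewrite mulr0 add0r.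
rewrite -{1}(subnK (ltnW ij)) exprD => h.
apply: (mulIf p0); apply: (mulIf (expf_neq0 i eta0)); rewrite divfK //.
by rewrite mulrBl mul1r h exprVn [RHS]mulrC !mulrA mulfV ?expf_neq0 // mul1r mulrC.
Qed.
End PLocal.

Lemma int_poly_root (eta : algC) :
  exists2 P : {poly int}, P != 0 & root (map_poly intr P) eta.
Proof.
have [q [qE mq] rq] := minCpolyP eta.
have [P [a a0 PE]] := rat_poly_scale q.
have P0 : P != 0.
  apply: contraTneq mq => P0; rewrite PE P0 map_poly0 scaler0.
  by rewrite monicE lead_coef0 eq_sym oner_eq0.
exists P => //; have := root_minCpoly eta; rewrite qE PE.
rewrite map_polyZ /= rootZ ?fmorph_eq0 ?invr_eq0 ?intr_eq0 //.
rewrite -map_poly_comp; congr (root _ _); apply: eq_map_poly => x /=.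
by rewrite ratr_int.
Qed.

(** If a is the leading coefficient of an equation of eta, then a * eta is
    integral. *)
Lemma Aint_denominator (eta : algC) : exists2 D : nat, (0 < D)%N & D%:R * eta \in Aint.
Proof.
have [P P0 rP] := int_poly_root eta.
set n := (size P).-1; set a := lead_coef P.
have a0 : a != 0 by rewrite lead_coef_eq0.
have sP : size P = n.+1 by rewrite prednK // size_poly_gt0.
have n0 : (0 < n)%N.
  rewrite lt0n; apply/eqP => nE; move: sP rP P0; rewrite nE => /eqP/size_poly1P[c c0 ->].
  by rewrite map_polyC rootC /= intr_eq0 (negbTE c0).
suff aA : a%:~R * eta \in Aint.
  exists `|a|%N; first by rewrite absz_gt0.
  by case: (a) aA => k //=; rewrite NegzE mulrNz mulNr rpredN.
pose c i : int := if i == n then 1 else P`_i * a ^+ (n.-1 - i).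
(* The monic polynomial a^(n-1) P(X / a). *)
pose Q : {poly algC} := \poly_(i < n.+1) (c i)%:~R.
have sQ : size Q = n.+1 by rewrite size_poly_eq // /c eqxx oner_eq0.
apply: (@root_monic_Aint Q).
- rewrite rootE (horner_coef_wide _ (n := n.+1)) ?sQ //.
  rewrite (eq_bigr (fun i : 'I_n.+1 => (a ^+ n.-1)%:~R * ((P`_i)%:~R * eta ^+ i))).
    rewrite -mulr_sumr; move: rP; rewrite rootE horner_coef size_map_poly_id0.
      rewrite sP => /eqP E; rewrite [X in _ * X](_ : _ = 0) ?mulr0 //.
      by rewrite -[RHS]E; apply: eq_bigr => i _; rewrite coef_map.
    by rewrite intr_eq0.
  move=> i _; rewrite coef_poly ltn_ord /c exprMn.
  have [->|ni] := eqVneq (i : nat) n.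
    have -> : P`_n = a by rewrite /a lead_coefE.
    rewrite mul1r mulrA -intrM -exprSr prednK // rmorphXn //.
  rewrite [LHS]mulrA [RHS]mulrA -!intrM -rmorphXn -intrM; congr (_%:~R * _).
  rewrite [RHS]mulrC -mulrA; congr (_ * _); rewrite -exprD subnK //.
  by have := ltn_ord i; lia.
- by rewrite monicE lead_coefE sQ /= coef_poly ltnSn /c eqxx.
- by apply/polyOverP => i; rewrite coef_poly; case: ifP => _; rewrite ?rpred0 ?intr_int.
Qed.

Lemma torsion_at_good_primes (etas : seq algC) : 0 \notin etas ->
  exists2 M, (0 < M)%N & forall p, prime p -> ~~ (p %| M)%N ->
  forall eta, eta \in etas -> [/\ p_integral p eta, p_integral p eta^-1 &
    exists2 N, (0 < N)%N & p_integral p ((eta ^+ N - 1) / p%:R)].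
Proof.
elim: etas => [_|eta etas IH]; first by exists 1%N.
rewrite inE negb_or eq_sym => /andP[eta0 /IH[M M0 MP]].
have [D D0 hD] := Aint_denominator eta.
have [E E0 hE] := Aint_denominator eta^-1.
have [P P0 rP] := int_poly_root eta.
exists (D * E * `|lead_coef P| * M)%N.
  by rewrite !muln_gt0 D0 E0 absz_gt0 lead_coef_eq0 P0.
move=> p p_pr; rewrite !Euclid_dvdM // !negb_or => /andP[/andP[/andP[pD pE] pP] pM] x.
rewrite inE => /orP[/eqP ->|]; last exact: MP.
have h1 : p_integral p eta by exists D.
have h2 : p_integral p eta^-1 by exists E.
split => //; apply: (torsion_mod_p p_pr rP) => //.
apply: contraNneq pP => h; have := congr1 (fun q : {poly 'F_p} => q`_(size P).-1) h.
by rewrite coef_map coef0 -lead_coefE => /eqP; rewrite intr_Fp_eq0.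
Qed.

(** * A subring separated at a prime *)

Definition separated_at (F : numFieldType) (S : set F) (p : nat) : Prop :=
  forall x, (forall k, S (x / p%:R ^+ k)) -> x = 0.

(** All primes but finitely many are allowed, so that p can later be chosen odd
    and prime to a determinant.  The ring is generated by the ys, their
    inverses and the (y^N - 1) / p; as it is noetherian, separatedness amounts
    to 1 / p not being in it. *)
Theorem separated_subring (F : numFieldType) (ys : seq F) : 0 \notin ys ->
  exists2 M, (0 < M)%N & forall p, prime p -> ~~ (p %| M)%N ->
  exists (S : set F) (N : nat), [/\ is_subring S, (0 < N)%N, separated_at S p &
    forall y, y \in ys -> [/\ S y, S y^-1 & S ((y ^+ N - 1) / p%:R)]].
Proof.
move=> ys0.
pose gens := ys ++ [seq y^-1 | y <- ys].
pose S0 := adjoins gens; have hS0 : is_subring S0 := adjoins_subring gens.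
have ygen y : y \in ys -> S0 y by move=> hy; apply: adjoins_mem; rewrite mem_cat hy.
have yVgen y : y \in ys -> S0 y^-1.
  by move=> hy; apply: adjoins_mem; rewrite mem_cat (map_f (@GRing.inv F) hy) orbT.
have [h hh _] := specialisable_adjoins (subring1 hS0) (oner_neq0 F).
have hV y : y \in ys -> h y != 0 /\ h y^-1 = (h y)^-1.
  move=> hy; have y0 : y != 0 by apply: contraNneq ys0 => <-.
  have E : h y * h y^-1 = 1.
    by rewrite -(homM hh) ?divff ?(hom1 hh) //; [exact: ygen | exact: yVgen].
  have hy0 : h y != 0 by apply: contra_eq_neq E => ->; rewrite mul0r eq_sym oner_eq0.
  by split=> //; apply: (mulfI hy0); rewrite E divff.
have [|M M0 MP] := @torsion_at_good_primes [seq h y | y <- ys].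
  by apply/mapP => -[y /hV[hy _] E]; rewrite -E eqxx in hy.
exists M => // p p_pr pM.
have hO := p_integral_subring p_pr.
have p0 : p%:R != 0 :> F by rewrite pnatr_eq0 -lt0n prime_gt0.
have p0' : p%:R != 0 :> algC by rewrite pnatr_eq0 -lt0n prime_gt0.
have /choice[N NP] : forall y, exists N, y \in ys ->
    [/\ p_integral p (h y), p_integral p (h y)^-1, (0 < N)%N &
      p_integral p ((h y ^+ N - 1) / p%:R)].
  move=> y; have [hy|] := boolP (y \in ys); last by exists 0%N.
  by have [h1 h2 [N N0 h3]] := MP p p_pr pM _ (map_f h hy); exists N.
pose zs := [seq (y ^+ N y - 1) / p%:R | y <- ys].
pose S := adjoins (zs ++ gens); have hS : is_subring S := adjoins_subring (zs ++ gens).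
have SpX k : S0 (p%:R ^+ k) by apply: subringX => //; exact: subring_nat.
have hpX k : h (p%:R ^+ k) = p%:R ^+ k by rewrite (homX hS0 hh) ?(hom_nat hS0 hh) //; exact: subring_nat.
(* The specialisation h extends to the ring S0[1/p]; the elements of G are those
   with a p-integral value. *)
pose G := [set w | exists2 k, S0 (p%:R ^+ k * w) &
                   p_integral p (h (p%:R ^+ k * w) / p%:R ^+ k)].
have hG : is_subring G.
  split.
  - exists 0%N; rewrite expr0 mulr1; first exact: subring1.
    by rewrite (hom1 hh) divr1; exact: subring1.
  - move=> a b [k ka hka] [l lb hlb]; exists (k + l)%N.
      rewrite mulrBr; apply: subringB => //; rewrite exprD -mulrA.
        by rewrite mulrCA; apply: subringM.
      by apply: subringM.
    have -> : p%:R ^+ (k + l) * (a - b) =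
      p%:R ^+ l * (p%:R ^+ k * a) - p%:R ^+ k * (p%:R ^+ l * b) :> F.
      by rewrite exprD; ring.
    rewrite (homB hh (subringM hS0 (SpX l) ka) (subringM hS0 (SpX k) lb)).
    rewrite (homM hh (SpX l) ka) (homM hh (SpX k) lb) !hpX mulrBl.
    have -> : p%:R ^+ l * h (p%:R ^+ k * a) / p%:R ^+ (k + l) =
      h (p%:R ^+ k * a) / p%:R ^+ k :> algC by rewrite exprD; field; rewrite !expf_neq0.
    have -> : p%:R ^+ k * h (p%:R ^+ l * b) / p%:R ^+ (k + l) =
      h (p%:R ^+ l * b) / p%:R ^+ l :> algC by rewrite exprD; field; rewrite !expf_neq0.
    exact: subringB.
  - move=> a b [k ka hka] [l lb hlb]; exists (k + l)%N.
      by rewrite exprD mulrACA; apply: subringM.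
    rewrite exprD mulrACA (homM hh) //.
    by rewrite [p%:R ^+ (k + l)]exprD -mulf_div; apply: subringM.
have SG : S `<=` G.
  apply: adjoins_min => // w; rewrite mem_cat => /orP[/mapP[y hy ->]|].
    have [h1 h2 N0 h3] := NP _ hy.
    have E : p%:R ^+ 1 * ((y ^+ N y - 1) / p%:R) = y ^+ N y - 1.
      by rewrite expr1 mulrC divfK.
    have Sy := ygen _ hy.
    exists 1%N; rewrite E.
      by apply: subringB => //; [exact: subringX | exact: subring1].
    rewrite (homB hh) ?(hom1 hh) ?(homX hS0 hh) //; first exact: subringX.
    exact: subring1.
  rewrite mem_cat => /orP[hy|/mapP[y hy ->]].
    by exists 0%N; rewrite expr0 mul1r ?divr1; [exact: ygen | case: (NP _ hy)].
  exists 0%N; rewrite expr0 mul1r ?divr1; first exact: yVgen.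
  by have [_ ->] := hV _ hy; case: (NP _ hy).
have pG : ~ S p%:R^-1.
  move=> /SG[k hk hO']; apply: (p_integral_inv p_pr).
  suff -> : p%:R^-1 = h (p%:R ^+ k / p%:R) / p%:R ^+ k :> algC by [].
  apply: (mulIf p0'); rewrite mulVf // mulrAC.
  have := homM hh hk (subring_nat hS0 p).
  by rewrite divfK // hpX (hom_nat hS0 hh) => <-; rewrite divff // expf_neq0.
exists S, (\prod_(y <- ys) N y)%N; split => //.
- rewrite big_seq prodn_cond_gt0 // => y hy; by case: (NP _ hy).
- move=> x hx; apply: contrapT => /eqP x0; apply: pG.
  apply: (noetherian_separated hS _ _ p0 x0) => //; first exact: noetherian_adjoins.
  exact: subring_nat.
- move=> y hy; have Sy : S y by apply: adjoins_mem; rewrite !mem_cat hy orbT.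
  split => //; first by apply: adjoins_mem; rewrite !mem_cat (map_f (@GRing.inv F) hy) !orbT.
  have : (N y %| \prod_(y <- ys) N y)%N.
    by rewrite (big_rem y) //=; exact: dvdn_mulr.
  move=> /dvdnP[m ->]; rewrite mulnC exprM subrX1 mulrAC; apply: subringM => //.
    by apply: adjoins_mem; rewrite mem_cat (map_f (fun y => (y ^+ N y - 1) / p%:R)).
  by apply: subring_sum => // i _; do 2 apply: subringX => //.
Qed.

(** * Smooth sequences *)

Section Smooth.
Variables (F : numFieldType) (S : set F) (p : nat).
Hypotheses (hS : is_subring S) (p_pr : prime p) (p_odd : (2 < p)%N).

Let pF_neq0 : p%:R != 0 :> F.
Proof. by rewrite pnatr_eq0 -lt0n prime_gt0. Qed.

Definition pdelta (u : nat -> F) (l : nat) : F := (u l.+1 - u l) / p%:R.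

(** The differences of u of order j are divisible by p^j, for all j up to i.
    This recursive form makes the stability under products a direct induction. *)
Fixpoint smooth (i : nat) (u : nat -> F) : Prop :=
  (forall l, S (u l)) /\ if i is j.+1 then smooth j (pdelta u) else True.

Lemma smooth_mem i u : smooth i u -> forall l, S (u l).
Proof. by case: i => [|i] []. Qed.

Lemma smoothW i u : smooth i.+1 u -> smooth i u.
Proof. by elim: i u => [|i IH] u [h1 h2]; split => //; exact: IH. Qed.

Lemma smooth_ext i u v : u =1 v -> smooth i u -> smooth i v.
Proof. by move=> /funext ->. Qed.

Lemma smooth_shift i u : smooth i u -> smooth i (fun l => u l.+1).
Proof.
elim: i u => [|i IH] u [h1 h2]; split => //.
exact: IH h2.
Qed.

Lemma smooth_cst i a : S a -> smooth i (fun=> a).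
Proof.
elim: i a => [|i IH] a ha; split => //.
apply: (smooth_ext (u := fun=> 0)); last by apply: IH; exact: subring0.
by move=> l; rewrite /pdelta subrr mul0r.
Qed.

Lemma smoothD i u v : smooth i u -> smooth i v -> smooth i (fun l => u l + v l).
Proof.
elim: i u v => [|i IH] u v [u1 u2] [v1 v2]; split => //; try by move=> l; exact: subringD.
apply: smooth_ext (IH _ _ u2 v2) => l.
by rewrite /pdelta -mulrDl addrACA opprD.
Qed.

(** Leibniz rule: the difference of u v is (Delta u) (E v) + u (Delta v), with
    E the shift. *)
Lemma smoothM i u v : smooth i u -> smooth i v -> smooth i (fun l => u l * v l).
Proof.
elim: i u v => [|i IH] u v hu hv.
  by case: hu hv => [u1 _] [v1 _]; split => // l; exact: subringM.
split; first by move=> l; exact: subringM (smooth_mem hu l) (smooth_mem hv l).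
have := smoothD (IH _ _ hu.2 (smooth_shift (smoothW hv))) (IH _ _ (smoothW hu) hv.2).
apply: smooth_ext => l; rewrite /pdelta mulrAC mulrA -mulrDl; congr (_ / _).
by rewrite mulrBl mulrBr addrA subrK.
Qed.

Lemma smoothZ i a u : S a -> smooth i u -> smooth i (fun l => a * u l).
Proof. by move=> ha hu; apply: smoothM => //; exact: smooth_cst. Qed.

Lemma smooth_prod i (I : Type) (r : seq I) (u : I -> nat -> F) :
  (forall j, smooth i (u j)) -> smooth i (fun l => \prod_(j <- r) u j l).
Proof.
move=> h; elim: r => [|a r IH].
  apply: (smooth_ext (u := fun=> 1)); first by move=> l; rewrite big_nil.
  exact: smooth_cst (subring1 hS).
by apply: smooth_ext (smoothM (h a) IH) => l; rewrite big_cons.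
Qed.

(** The analogue of [smooth] for integer sequences; the quotients have to be
    integers, not merely elements of S, to be used as exponents. *)
Fixpoint smooth_int (i : nat) (g : nat -> int) : Prop :=
  if i is j.+1 then exists2 g', smooth_int j g' & forall l, g l.+1 = g l + p%:Z * g' l
  else True.

Lemma smooth_intW i g : smooth_int i.+1 g -> smooth_int i g.
Proof.
elim: i g => [//|i IH] g [g' hg' E]; exists g' => //; exact: IH.
Qed.

Lemma unit_power_mem (Y : F) (a : F) (g : int) : Y != 0 ->
  S Y -> S Y^-1 -> S ((Y - 1) / a) -> S (Y ^ g) /\ S ((Y ^ g - 1) / a).
Proof.
move=> Y0 SY SYV SY1.
have nat_case (n : nat) : S (Y ^+ n) /\ S ((Y ^+ n - 1) / a).
  split; first exact: subringX.
  rewrite subrX1 mulrAC; apply: subringM => //.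
  by apply: subring_sum => // i _; exact: subringX.
case: g => n; first exact: nat_case.
have SV : S (Y ^- n.+1) by rewrite -exprVn; exact: subringX.
rewrite NegzE -exprnN; split=> //.
have -> : (Y ^- n.+1 - 1) / a = - (Y ^- n.+1 * ((Y ^+ n.+1 - 1) / a)).
  by rewrite mulrA mulrBr mulVf ?expf_neq0 // mulr1 -mulNr opprB.
by apply: subringN => //; apply: subringM => //; case: (nat_case n.+1).
Qed.

(** The difference of Y^g is Y^g ((Y^p)^g' - 1), where p g' is the difference
    of g, and Y^p is closer to 1 than Y by a factor p: the induction trades one
    order of smoothness for one power of p. *)
Lemma smooth_unit_power i s (Y : F) g : (0 < s)%N -> Y != 0 -> S Y -> S Y^-1 ->
  S ((Y - 1) / p%:R ^+ s) -> smooth_int i g ->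
  smooth i (fun l => (Y ^ g l - 1) / p%:R ^+ s).
Proof.
elim: i s Y g => [|i IH] s Y g s0 Y0 SY SYV SY1 hg.
  by split=> // l; case: (unit_power_mem (g l) Y0 SY SYV SY1).
split; first by move=> l; case: (unit_power_mem (g l) Y0 SY SYV SY1).
case: (hg) => g' hg' gE.
have SYp : S ((Y ^+ p - 1) / p%:R ^+ s.+1).
  have -> : (Y ^+ p - 1) / p%:R ^+ s.+1 =
      (Y - 1) / p%:R ^+ s * (\sum_(k < p) (Y ^+ k - 1) / p%:R + 1).
    rewrite -mulr_suml sumrB sumr_const card_ord [X in _ * (X + 1)]mulrBl divff // subrK.
    by rewrite subrX1 exprSr mulf_div.
  apply: subringM => //; apply: subringD (subring1 hS) => //.
  apply: subring_sum => // k _.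
  have SY1p : S ((Y - 1) / p%:R).
    rewrite -(prednK s0) exprS in SY1.
    have -> : (Y - 1) / p%:R = p%:R ^+ s.-1 * ((Y - 1) / (p%:R * p%:R ^+ s.-1)).
      by field; rewrite pF_neq0 expf_neq0.
    by apply: subringM => //; apply: subringX => //; exact: subring_nat.
  by case: (unit_power_mem k Y0 SY SYV SY1p).
have h1 : smooth i (fun l => Y ^ g l).
  have := smoothD (smooth_cst i (subring1 hS))
    (smoothZ (subringX hS s (subring_nat hS p)) (IH s Y g s0 Y0 SY SYV SY1 (smooth_intW hg))).
  by apply: smooth_ext => l; rewrite mulrC divfK ?expf_neq0 // addrC subrK.
have h2 := IH s.+1 (Y ^+ p) g' isT (expf_neq0 _ Y0) (subringX hS p SY).
have SYVp : S (Y ^- p) by rewrite -exprVn; exact: subringX.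
have {}h2 := h2 SYVp SYp hg'.
apply: smooth_ext (smoothM h1 h2) => l.
rewrite /pdelta gE expfzDr // -exprz_exp -[Y ^ p%:Z]/(Y ^+ p) exprS.
by field; rewrite pF_neq0 expf_neq0.
Qed.

(** * Zeros of analytic sequences *)

Definition analytic (u : nat -> F) : Prop := forall i, smooth i u.

Lemma analytic_iter i u l : analytic u -> S (iter i pdelta u l).
Proof.
move=> h; suff : analytic (iter i pdelta u) by move=> /(_ 0%N)[+ _]; apply.
elim: i => [|i IH] //= j; by case: (IH j.+1).
Qed.

(** Newton's interpolation formula: apply the l-th power of E = 1 + p * pdelta
    at 0. *)
Lemma newton u l n : (l < n)%N ->
  u l = \sum_(i < n) ('C(l, i))%:R * (p%:R ^+ i * iter i pdelta u 0%N).
Proof.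
elim: l u n => [|l IH] u [//|n] ln.
  rewrite big_ord_recl big1 ?addr0 ?bin0 ?mul1r // => i _.
  by rewrite bin0n mul0r.
have E : u l.+1 = u l + p%:R * pdelta u l.
  by rewrite /pdelta mulrC divfK // addrC subrK.
rewrite E (IH u n.+1 (ltnW ln)) (IH (pdelta u) n ln) big_ord_recl [RHS]big_ord_recl.
rewrite !bin0 -addrA; congr (_ + _).
rewrite mulr_sumr -big_split /=; apply: eq_bigr => i _.
rewrite /bump /= binS natrD mulrDl; congr (_ + _).
by rewrite mulrCA [p%:R * (_ * _)]mulrA -exprS -iterSr.
Qed.

(** Legendre's formula gives v_p(n!) <= n / (p - 1). That p is odd matters: for
    p = 2 the differences of 1 + (-1)^l are divisible by 2^i, and this sequence
    has infinitely many zeros. *)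
Lemma logn_fact_half n : (2 * logn p n`! <= n)%N.
Proof.
rewrite logn_fact //.
suff key m : forall n, (2 * \sum_(1 <= k < m.+1) n %/ p ^ k <= n)%N by exact: key.
elim: m => [|m IH] {}n; first by rewrite big_geq.
rewrite big_nat_recl // expn1.
under eq_bigr => k _ do rewrite expnS divnMA.
rewrite mulnDr; apply: (@leq_trans (2 * (n %/ p) + n %/ p)).
  by rewrite leq_add2l; exact: IH.
have := leq_trunc_div n p; have := p_odd; nia.
Qed.

(** Divisibility of the coefficients by powers of p that grow with the degree;
    k measures the gain from the linear factors already divided out. *)
Definition steep k (Q : {poly F}) : Prop :=
  forall j, S (Q`_j / p%:R ^+ ((j + k)./2)).

Lemma div_pX_le (x : F) a b : (a <= b)%N -> S (x / p%:R ^+ b) -> S (x / p%:R ^+ a).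
Proof.
move=> ab h; have -> : x / p%:R ^+ a = p%:R ^+ (b - a) * (x / p%:R ^+ b).
  rewrite -{2}(subnK ab) exprD; by field; rewrite !expf_neq0.
by apply: subringM => //; apply: subringX => //; exact: subring_nat.
Qed.

(** If P = Q (X - t), then Q_j = P_(j+1) + t Q_(j+1): from the top down, the
    coefficient of degree j of Q is as divisible as that of degree j + 1 of P. *)
Lemma steep_div k (Q : {poly F}) (t : nat) : steep k (Q * ('X - t%:R%:P)) -> steep k.+1 Q.
Proof.
move=> h; suff key m : forall j, (size Q <= j + m)%N -> S (Q`_j / p%:R ^+ ((j + k.+1)./2)).
  by move=> j; apply: (key (size Q)); exact: leq_addl.
elim: m => [|m IH] j sj.
  by rewrite nth_default ?mul0r; [exact: subring0 | rewrite addn0 in sj].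
have E : Q`_j = (Q * ('X - t%:R%:P))`_j.+1 + t%:R * Q`_j.+1.
  by rewrite mulrBr coefB coefMX coefMC /= mulrC subrK.
rewrite E mulrDl; apply: subringD => //; first by rewrite addnS -addSn; exact: h.
rewrite -mulrA; apply: subringM => //; first exact: subring_nat.
apply: (@div_pX_le _ _ ((j.+1 + k.+1)./2)); first by apply: half_leq; rewrite leq_add2r.
by apply: IH; rewrite addSn -addnS.
Qed.

Lemma steep_eval k (Q : {poly F}) (ts : seq nat) (l : nat) : uniq ts ->
  (forall t, t \in ts -> Q.[t%:R] = 0) -> steep k Q ->
  S (Q.[l%:R] / p%:R ^+ ((k + size ts)./2)).
Proof.
elim: ts k Q => [|t ts IH] k Q /=.
  move=> _ _ h; rewrite addn0 horner_coef mulr_suml; apply: subring_sum => // i _.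
  rewrite mulrAC; apply: subringM => //; last by apply: subringX => //; exact: subring_nat.
  by apply: div_pX_le (h i); apply: half_leq; exact: leq_addl.
move=> /andP[tts uts] hz h.
have /factor_theorem[Q' QE] : root Q t%:R by rewrite rootE hz ?mem_head.
have h' : steep k.+1 Q' by apply: (@steep_div _ _ t); rewrite -QE.
rewrite QE hornerM mulrAC; apply: subringM => //; last first.
  rewrite hornerXsubC; apply: subringB => //; exact: subring_nat.
rewrite addnS -addSn; apply: IH => // s hs.
have /eqP : Q.[s%:R] = 0 by apply: hz; rewrite inE hs orbT.
rewrite QE hornerM hornerXsubC mulf_eq0 => /orP[/eqP //|].
by rewrite subr_eq0 eqr_nat => /eqP st; rewrite -st hs in tts.
Qed.

Definition falling (i : nat) : {poly F} := \prod_(j < i) ('X - j%:R%:P).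

Lemma falling_eval i (l : nat) : (falling i).[l%:R] = (l ^_ i)%:R.
Proof.
rewrite /falling horner_prod; elim: i => [|i IH]; first by rewrite big_ord0 ffactn0.
rewrite big_ord_recr /= IH ffactnSr natrM hornerXsubC.
have [il|li] := leqP i l; first by rewrite natrB.
by rewrite ffact_small ?mul0r.
Qed.

Lemma falling_coef i j : S (falling i)`_j /\ ((i < j)%N -> (falling i)`_j = 0).
Proof.
split; last by move=> ij; rewrite nth_default // size_prod_XsubC /index_enum -enumT size_enum_ord.
have : coefs_in S (falling i); last exact.
apply: big_ind => [|a b|k _]; first exact: coefs_inC (subring1 hS).
  exact: coefs_inM.
by apply: coefs_inB => //; [exact: coefs_inX | exact: coefs_inC (subring_nat hS k)].
Qed.

Lemma half_bound i : (logn p i`! + i./2 <= i)%N.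
Proof. by have := logn_fact_half i; lia. Qed.

(** Interpolate u up to a range containing l and the zeros ts.  The coefficient
    of the i-th falling factorial is p^i / i!  times an element of S; it is
    divisible by p^(i/2) once the factor D, prime to p, has cleared the
    denominators.  Dividing by the linear factors X - t raises this to the
    announced power of p, and D is removed by a Bezout relation between D and
    this power. *)
Lemma zero_estimate u (ts : seq nat) (l : nat) : analytic u -> uniq ts ->
  (forall t, t \in ts -> u t = 0) -> S (u l / p%:R ^+ (size ts)./2).
Proof.
move=> hu uts hz.
have [n ln tn] : exists2 n, (l < n)%N & forall t, t \in ts -> (t < n)%N.
  exists (l + sumn ts).+1; first by rewrite ltnS leq_addr.
  move=> t ht; rewrite ltnS; apply: leq_trans (leq_addl _ _).
  by rewrite (perm_sumn (perm_to_rem ht)) /= leq_addr.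
(* The part of i! prime to p. *)
pose m i := (i`! %/ p ^ logn p i`!)%N.
pose v i := logn p i`!.
have mE i : (i`! = p ^ v i * m i)%N by rewrite mulnC divnK // pfactor_dvdnn.
have m0 i : ~~ (p %| m i)%N.
  apply/negP => /dvdnP[e eE]; have := pfactor_dvdn (v i).+1 p_pr (fact_gt0 i).
  by rewrite ltnn [X in (_ %| X)%N]mE eE mulnCA -expnSr dvdn_mull.
pose D := (\prod_(i < n) m i)%N.
have D0 : ~~ (p %| D)%N.
  by apply: (big_ind (fun x => ~~ (p %| x)%N)) => [|a b ha hb|i _ //]; [rewrite Euclid_dvd1 | rewrite Euclid_dvdM // negb_or ha].
pose d i := iter i pdelta u 0%N.
pose c i : F := D%:R * p%:R ^+ i / (i`!)%:R * d i.
have cS (i : 'I_n) j : (j <= i)%N -> S (c i / p%:R ^+ j./2).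
  move=> ji; apply: (@div_pX_le _ _ i./2); first exact: half_leq.
  have [e De] : exists e, (D = m i * e)%N by exists (\prod_(k < n | k != i) m k)%N; rewrite /D (bigD1 i).
  have hb : (v i + i./2 <= i)%N := half_bound i.
  have pE : p%:R ^+ i = p%:R ^+ (i - (v i + i./2)) * (p%:R ^+ v i * p%:R ^+ i./2) :> F.
    by rewrite -!exprD subnK.
  have mi0 : (m i)%:R != 0 :> F.
    by rewrite pnatr_eq0; apply: contraNneq (m0 i) => ->; rewrite dvdn0.
  have -> : c i / p%:R ^+ i./2 = e%:R * p%:R ^+ (i - (v i + i./2)) * d i.
    rewrite /c De mE !natrM natrX pE.
    by field; rewrite mi0 !expf_neq0.
  apply: subringM => //; last exact: analytic_iter.
  by apply: subringM => //; [exact: subring_nat | apply: subringX => //; exact: subring_nat].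
pose Q : {poly F} := \sum_(i < n) c i *: falling i.
have QE k : (k < n)%N -> Q.[k%:R] = D%:R * u k.
  move=> kn; rewrite /Q horner_sum (newton u kn) mulr_sumr; apply: eq_bigr => i _.
  rewrite hornerZ falling_eval -bin_ffact natrM /c /d.
  by field; rewrite pnatr_eq0 -lt0n fact_gt0.
have hQ : steep 0 Q.
  move=> j; rewrite /Q addn0 coef_sum mulr_suml; apply: subring_sum => // i _.
  rewrite coefZ mulrAC; have [f1 f2] := falling_coef i j.
  have [ij|ji] := ltnP i j; first by rewrite f2 // mulr0; exact: subring0.
  by apply: subringM => //; exact: cS.
have := steep_eval l uts _ hQ; rewrite add0n QE // => /(_ _)h1.
have {}h1 : S (D%:R * u l / p%:R ^+ (size ts)./2).
  by apply: h1 => t ht; rewrite QE ?tn // hz // mulr0.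
have Su : S (u l) := smooth_mem (hu 0%N) l.
set q := (size ts)./2 in h1 *.
have cop : coprimez D%:Z (p%:Z ^+ q).
  by rewrite coprimezE abszX /= coprime_sym coprimeXl // prime_coprime.
have [[a b] /= ab] := coprimezP _ _ cop.
have -> : u l / p%:R ^+ q = a%:~R * (D%:R * u l / p%:R ^+ q) + b%:~R * u l.
  have E : a%:~R * D%:R + b%:~R * p%:R ^+ q = 1 :> F.
    by have := congr1 (intr : int -> F) ab; rewrite intrD !intrM rmorphXn.
  rewrite -[LHS]mul1r -[X in X * _]E; field; by rewrite expf_neq0.
by apply: subringD => //; apply: subringM => //; exact: subring_int.
Qed.

Lemma infinite_zeros u : (forall b, exists2 k, (b < k)%N & u k = 0 :> F) ->
  forall m, exists ts, [/\ uniq ts, size ts = m & forall t, t \in ts -> u t = 0].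
Proof.
move=> h; elim=> [|m [ts [uts <- hts]]]; first by exists [::].
have [k kb uk] := h (sumn ts); exists (k :: ts); split => //=.
  rewrite uts andbT; apply: contraTN kb => hk; rewrite -leqNgt.
  by rewrite (perm_sumn (perm_to_rem hk)) /= leq_addr.
by move=> t; rewrite inE => /orP[/eqP ->|/hts].
Qed.

Theorem analytic_zeros u : separated_at S p -> analytic u ->
  (forall b, exists2 k, (b < k)%N & u k = 0) -> forall l, u l = 0.
Proof.
move=> hsep hu /infinite_zeros h l; apply: hsep => k.
have [ts [uts sts hts]] := h (k.*2).
by have := zero_estimate l hu uts hts; rewrite sts doubleK.
Qed.

(** Elimination: if a_0 does not vanish identically, a common zero k0 of the
    relation with a_0(k0) <> 0 allows one to express c_0 by the other
    coefficients, which leaves a relation with fewer terms between the analytic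
    sequences a_0(k0) a_i - a_i(k0) a_0. *)
Theorem analytic_zeros_span n (c : 'I_n -> F) (a : 'I_n -> nat -> F) :
  separated_at S p -> (forall i, analytic (a i)) ->
  (forall b, exists2 k, (b < k)%N & \sum_i c i * a i k = 0) ->
  forall l, \sum_i c i * a i l = 0.
Proof.
move=> hsep; elim: n c a => [|n IH] c a ha hz l; first by rewrite big_ord0.
have [a0|/existsNP[k1 ak1]] := pselect (forall k, a ord0 k = 0).
  have E k : \sum_i c i * a i k = \sum_i c (lift ord0 i) * a (lift ord0 i) k.
    by rewrite big_ord_recl a0 mulr0 add0r.
  rewrite E; apply: (IH (fun i => c (lift ord0 i)) (fun i => a (lift ord0 i))) => // b.
  by have [k bk hk] := hz b; exists k; rewrite // -E.
have [k0 ak0 hk0] : exists2 k0, a ord0 k0 != 0 & \sum_i c i * a i k0 = 0.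
  apply: contrapT => no; apply: ak1; apply: analytic_zeros => // b.
  have [k bk hk] := hz b; exists k => //; apply: contrapT => /eqP ak.
  by apply: no; exists k.
have E k : a ord0 k0 * (\sum_i c i * a i k) = \sum_i c (lift ord0 i) *
    (a ord0 k0 * a (lift ord0 i) k + - a (lift ord0 i) k0 * a ord0 k).
  move: hk0; rewrite !big_ord_recl => /eqP; rewrite addr_eq0 => /eqP h0.
  rewrite mulrDr [X in X + _](_ : _ = c ord0 * a ord0 k0 * a ord0 k); last by ring.
  rewrite h0 mulNr mulr_suml mulr_sumr addrC -sumrB; apply: eq_bigr => i _; ring.
suff : a ord0 k0 * (\sum_i c i * a i l) = 0.
  by move=> /eqP; rewrite mulf_eq0 (negbTE ak0) => /eqP.
have Sa i k : S (a i k) by exact: smooth_mem (ha i 0%N) k.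
rewrite E; apply: (IH (fun i => c (lift ord0 i))
  (fun i k => a ord0 k0 * a (lift ord0 i) k + - a (lift ord0 i) k0 * a ord0 k)).
  by move=> i j; apply: smoothD; apply: smoothZ => //; [exact: ha | exact: subringN | exact: ha].
by move=> b; have [k bk hk] := hz b; exists k; rewrite // -E hk mulr0.
Qed.

End Smooth.

(** * Monomial orbits in a torus *)

Section MatrixPowers.
Variables (n : nat) (B : 'M[int]_n) (p N : nat).
Hypotheses (p_pr : prime p) (pB : ~~ (p %| \det B)%Z) (N0 : (0 < N)%N).

Lemma mx_divisible (q : int) m (X : 'M[int]_(m, n)) : (forall i j, (q %| X i j)%Z) ->
  exists Y, X = q *: Y.
Proof.
move=> h; exists (\matrix_(i, j) divz (X i j) q); apply/matrixP => i j.
by rewrite !mxE mulrC divzK.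
Qed.

Lemma mx_powers_pigeonhole (q : nat) : (0 < q)%N ->
  exists k0 N2 D, (0 < N2)%N /\ B ^+ k0 *m (B ^+ N2 - 1) = q%:Z *: D.
Proof.
move=> q0; have qz0 : q%:Z != 0 by rewrite -lt0n.
have [a [b [ab E]]] := pigeonhole (fun k =>
  \matrix_(i, j) inord `|modz ((B ^+ k) i j) q|%N : 'M['I_q.+1]_n).
have [|D DE] := @mx_divisible q%:Z n (B ^+ b - B ^+ a).
  move=> i j; rewrite !mxE -eqz_mod_dvd eq_sym; apply/eqP.
  have := congr1 (fun X : 'M['I_q.+1]_n => nat_of_ord (X i j)) E; rewrite !mxE.
  have lt x : (`|modz x q| < q.+1)%N.
    rewrite ltnS -lez_nat gez0_abs ?modz_ge0 // ltW //; exact: ltz_pmod.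
  rewrite !inordK // => /(congr1 Posz).
  by rewrite !gez0_abs ?modz_ge0.
exists a, (b - a)%N, D; split; first by rewrite subn_gt0.
by rewrite mulmxE mulrBr mulr1 -exprD subnKC // ltnW.
Qed.

Lemma adj_powers k : (\adj B) ^+ k *m B ^+ k = (\det B ^+ k)%:M.
Proof.
elim: k => [|k IH]; first by rewrite mulmxE mulr1.
rewrite exprSr [B ^+ _]exprS mulmxE -mulrA [_ * (B * _)]mulrA -!mulmxE mul_adj_mx.
by rewrite mul_scalar_mx -scalemxAr IH scale_scalar_mx exprS.
Qed.

(** Both congruences come from one coincidence B^k0 = B^(k0+N2) modulo p N.
    Modulo p one may cancel B^k0, with the help of the adjugate matrix; modulo
    N one may not, since N and the determinant can have common factors, which
    is why the exponents are only considered from k0 on. *)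
Lemma mx_powers : exists k0 N2 D E, [/\ (0 < N2)%N,
  B ^+ k0 *m (B ^+ N2 - 1) = (p * N)%:Z *: D & B ^+ N2 - 1 = p%:Z *: E].
Proof.
have pN0 : (0 < p * N)%N by rewrite muln_gt0 prime_gt0.
have [k0 [N2 [D [N20 DE]]]] := mx_powers_pigeonhole pN0.
have [|E EE] := @mx_divisible p%:Z n (B ^+ N2 - 1); last by exists k0, N2, D, E.
move=> i j.
have := congr1 (fun X => ((\adj B) ^+ k0 *m X) i j) DE.
rewrite mulmxA adj_powers mul_scalar_mx -scalemxAr [LHS]mxE [RHS]mxE => h.
have : (p%:Z %| \det B ^+ k0 * (B ^+ N2 - 1)%R i j)%Z.
  by rewrite h PoszM -mulrA; exact: dvdz_mulr.
rewrite Gauss_dvdzr // coprimezE abszX /= coprimeXr //.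
by rewrite prime_coprime.
Qed.

End MatrixPowers.

(** As B^N2 = 1 + p E, the difference of v B^(N2 l) is p times the same
    sequence for v E. *)
Lemma smooth_int_powers n (B E : 'M[int]_n) (p N2 : nat) i (v : 'rV[int]_n) j :
  B ^+ N2 - 1 = p%:Z *: E ->
  smooth_int p i (fun l => (v *m B ^+ (N2 * l)) 0 j).
Proof.
move=> hE; elim: i v => [//|i IH] v; exists (fun l => ((v *m E) *m B ^+ (N2 * l)) 0 j) => // l.
have -> : B ^+ (N2 * l.+1) = B ^+ (N2 * l) + p%:Z *: E *m B ^+ (N2 * l).
  rewrite -hE mulmxBl mul1mx addrC subrK mulnS exprD //.
by rewrite mulmxDr mxE -scalemxAl -scalemxAr mulmxA [X in _ + X]mxE.
Qed.

(** The exponents are e(l) = e(0) + N f(l) with f smooth to every order, so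
    that each y_j^e(l) is a constant times a power of y_j^N, which is congruent *)
Theorem monomial_orbit (F : numFieldType) n (y : 'I_n -> F) (B : 'M[int]_n) :
  (forall i, y i != 0) -> \det B != 0 ->
  exists k0 N, (0 < N)%N /\
  forall r k (c : 'I_k -> F) (m : 'I_k -> 'rV[int]_n),
  let u l := \sum_i c i * \prod_j y j ^ (m i *m B ^+ (k0 + r + N * l)) 0 j in
  (forall b, exists2 l, (b < l)%N & u l = 0) -> forall l, u l = 0.
Proof.
move=> y0 dB.
have [|M M0 MP] := @separated_subring F (codom y).
  by apply/mapP => -[i _ E]; have := y0 i; rewrite -E eqxx.
(* Such a prime is odd and divides neither M nor the determinant. *)
have [p] := prime_above (M * `|\det B| + 2).
move=> pgt p_pr; have dB0 : (0 < `|\det B|)%N by rewrite absz_gt0.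
have p_odd : (2 < p)%N by lia.
have pM : ~~ (p %| M)%N by rewrite gtnNdvd //; nia.
have pB : ~~ (p %| \det B)%Z by rewrite dvdzE /= gtnNdvd //; nia.
have [S [N [hS N0 hsep hy]]] := MP p p_pr pM.
have [k0 [N2 [D [E [N20 DE EE]]]]] := mx_powers p_pr pB N0.
exists k0, N2; split=> // r k c m u.
have ey i l j : (m i *m B ^+ (k0 + r + N2 * l)) 0 j =
    (m i *m B ^+ (k0 + r)) 0 j + N%:Z * (p%:Z * \sum_(t < l) (m i *m B ^+ r *m D *m B ^+ (N2 * t)) 0 j).
  elim: l => [|l IH]; first by rewrite muln0 addn0 big_ord0 !mulr0 addr0.
  rewrite big_ord_recr /= !mulrDr addrA -IH.
  have -> : B ^+ (k0 + r + N2 * l.+1) = B ^+ (k0 + r + N2 * l) +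
      (p * N)%:Z *: (B ^+ r *m D *m B ^+ (N2 * l)).
    have <- : B ^+ r *m (B ^+ k0 *m (B ^+ N2 - 1)) *m B ^+ (N2 * l) =
      (p * N)%:Z *: (B ^+ r *m D *m B ^+ (N2 * l)) by rewrite DE -scalemxAr -scalemxAl.
    rewrite mulmxE mulrBr mulr1 mulrBr mulrBl -!exprD mulnS.
    rewrite [(r + (k0 + N2) + _)%N](_ : _ = (k0 + r + (N2 + N2 * l))%N); last by lia.
    by rewrite [(r + k0 + _)%N](_ : _ = (k0 + r + N2 * l)%N) 1?addrC ?subrK //; lia.
  rewrite mulmxDr mxE -scalemxAr [X in _ + X]mxE !mulmxA PoszM; congr (_ + _).
  by rewrite mulrA [N%:Z * _]mulrC.
apply: (analytic_zeros_span hS p_pr p_odd hsep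
  (a := fun i l => \prod_j y j ^ (m i *m B ^+ (k0 + r + N2 * l)) 0 j)) => i e.
apply: smooth_prod => // j.
pose f l : int := p%:Z * \sum_(t < l) (m i *m B ^+ r *m D *m B ^+ (N2 * t)) 0 j.
have [Sy SyV SyN] := hy (y j) (codom_f y j).
have hf : smooth_int p e f.
  case: e => [//|e]; exists (fun l => (m i *m B ^+ r *m D *m B ^+ (N2 * l)) 0 j).
    exact: smooth_int_powers EE.
  by move=> l; rewrite /f big_ord_recr mulrDr.
have yN0 : y j ^+ N != 0 by rewrite expf_neq0.
have p0 : p%:R != 0 :> F by rewrite pnatr_eq0 -lt0n prime_gt0.
have h1 : smooth S p e (fun l => (y j ^+ N) ^ f l).
  have SV : S (y j ^+ N)^-1 by rewrite -exprVn; exact: subringX.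
  have := smoothD hS (smooth_cst p hS e (subring1 hS)) (smoothZ hS (subring_nat hS p)
    (smooth_unit_power hS p_pr (ltn0Sn 0) yN0 (subringX hS N Sy) SV SyN hf)).
  by apply: smooth_ext => l; rewrite expr1 mulrC divfK // addrC subrK.
have Sc : S (y j ^ (m i *m B ^+ (k0 + r)) 0 j).
  case: ((m i *m B ^+ (k0 + r)) 0 j) => t; first exact: subringX.
  by rewrite NegzE -exprnN -exprVn; exact: subringX.
apply: smooth_ext (smoothZ hS Sc h1) => l.
by rewrite ey expfzDr // -exprz_exp.
Qed.

(** * Farkas' lemma *)

(** Induction on the number of vectors (Bartl). If m0 separates b from the
    vectors other than g0 but is negative on g0, project everything along g0
    onto the kernel of m0 and apply the induction hypothesis there: both
    alternatives lift. *)
Lemma farkas (K : realFieldType) n r (g : 'I_r -> 'cV[K]_n) (b : 'cV[K]_n) :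
  (exists2 c : 'I_r -> K, forall i, 0 <= c i & b = \sum_i c i *: g i) \/
  (exists2 m : 'rV[K]_n, forall i, 0 <= (m *m g i) 0 0 & (m *m b) 0 0 < 0).
Proof.
elim: r g b => [|r IH] g b.
  have [->|b0] := eqVneq b 0; first by left; exists (fun=> 0); rewrite // big_ord0.
  right; exists (- b^T); first by case.
  have bb i : b^T 0 i * b i 0 = b i 0 ^+ 2 by rewrite mxE expr2.
  rewrite mulNmx mxE oppr_lt0 mxE; under eq_bigr => i _ do rewrite bb.
  rewrite lt0r sumr_ge0 ?andbT => [|i _]; last exact: sqr_ge0.
  apply: contraNneq b0 => /eqP; rewrite psumr_eq0 => [/allP h|i _]; last exact: sqr_ge0.
  apply/eqP/matrixP => i j; rewrite ord1 mxE.
  by have := h i (mem_index_enum _); rewrite /= sqrf_eq0 => /eqP.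
have [[c c0 bE]|[m0 m0g m0b]] := IH (fun i => g (lift ord0 i)) b.
  left; exists (fun i => if unlift ord0 i is Some j then c j else 0).
    by move=> i; case: unlift.
  rewrite big_ord_recl unlift_none scale0r add0r bE.
  by apply: eq_bigr => i _; rewrite liftK.
have [h0|h0] := leP 0 ((m0 *m g ord0) 0 0).
  right; exists m0 => // i.
  by case: (unliftP ord0 i) => [j ->|->].
pose a := - ((m0 *m g ord0) 0 0)^-1; have a0 : 0 < a by rewrite oppr_gt0 invr_lt0.
pose pr (v : 'cV[K]_n) := v + (a * (m0 *m v) 0 0) *: g ord0.
have [[c c0 bE]|[m1 m1g m1b]] := IH (fun i => pr (g (lift ord0 i))) (pr b).
  left; exists (fun i => if unlift ord0 i is Some j then c j else
     (\sum_i c i * (a * (m0 *m g (lift ord0 i)) 0 0) - a * (m0 *m b) 0 0)).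
    move=> i; case: unliftP => [j _|_]; first exact: c0.
    rewrite subr_ge0 (@le_trans _ _ 0) //; first by rewrite nmulr_lle0 ?ltW.
    by apply: sumr_ge0 => j _; rewrite mulr_ge0 // mulr_ge0 // ltW.
  rewrite big_ord_recl unlift_none.
  under [X in _ + X]eq_bigr => i _ do rewrite liftK.
  rewrite scalerBl scaler_suml -addrA [- _ + _]addrC addrA -big_split /=.
  apply/eqP; rewrite eq_sym subr_eq; apply/eqP; rewrite -[RHS]/(pr b) bE.
  by apply: eq_bigr => i _; rewrite /pr scalerDr scalerA addrC.
right; pose l := a * (m1 *m g ord0) 0 0; exists (m1 + l *: m0).
  move=> i; rewrite mulmxDl mxE -scalemxAl [X in _ + X]mxE.
  case: (unliftP ord0 i) => [j ->|->].
    have := m1g j; rewrite /pr mulmxDr mxE -scalemxAr [X in _ + X]mxE /l.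
    by rewrite mulrAC.
  rewrite (_ : _ + _ = 0) //; rewrite /l /a; field; by rewrite lt_eqF.
move: m1b; rewrite /pr mulmxDr mxE -scalemxAr [X in _ + X]mxE => m1b.
by rewrite mulmxDl mxE -scalemxAl [X in _ + X]mxE /l mulrAC.
Qed.

Lemma row_denominator n (m : 'rV[rat]_n) : exists2 d : int, 0 < d &
  exists m' : 'rV[int]_n, map_mx intr m' = d%:~R *: m.
Proof.
exists (\prod_k denq (m 0 k)); first by apply: prodr_gt0 => k _; exact: denq_gt0.
exists (\row_j (numq (m 0 j) * \prod_(k | k != j) denq (m 0 k))).
apply/matrixP => i j; rewrite ord1 !mxE [in RHS](bigD1 j) //= !rmorphM /=.
by rewrite numqE; ring.
Qed.

(** The alternative is decided over the rational numbers, so that the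
    separating form can be taken integral whatever the field K. *)
Lemma farkas_int (K : realFieldType) n r (g : 'I_r -> 'cV[int]_n) (b : 'cV[int]_n) :
  (exists2 c : 'I_r -> K, forall i, 0 <= c i &
     map_mx intr b = \sum_i c i *: map_mx intr (g i)) \/
  (exists2 m : 'rV[int]_n, forall i, 0 <= (m *m g i) 0 0 & (m *m b) 0 0 < 0).
Proof.
have [[c c0 bE]|[m mg mb]] := farkas (fun i => map_mx (intr : int -> rat) (g i)) (map_mx intr b).
  left; exists (fun i => ratr (c i)); first by move=> i; rewrite ler0q.
  have := congr1 (map_mx (ratr : rat -> K)) bE.
  have E (v : 'cV[int]_n) : map_mx (ratr : rat -> K) (map_mx intr v) = map_mx intr v.
    by apply/matrixP => i j; rewrite !mxE ratr_int.
  rewrite E => ->; rewrite raddf_sum; apply: eq_bigr => i _.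
  by rewrite -E; apply/matrixP => x y; rewrite !mxE; exact: (rmorphM (ratr : rat -> K)).
have [d d0 [m' m'E]] := row_denominator m.
have key (v : 'cV[int]_n) : ((m' *m v) 0 0)%:~R = d%:~R * (m *m map_mx intr v) 0 0 :> rat.
  have := congr1 (fun X : 'M[rat]_1 => X 0 0) (map_mxM (intr : int -> rat) m' v).
  by rewrite m'E -scalemxAl ![_ 0 0]mxE.
have d0' : 0 < d%:~R :> rat by rewrite ltr0z.
right; exists m' => [i|].
  by rewrite -(ler0z rat) key pmulr_rge0.
by rewrite -(ltrz0 rat) key pmulr_rlt0.
Qed.

(** * Rational cones *)

Section Cones.
Variables (R : realType) (n : nat).
Implicit Types (s t : set 'cV[R]_n) (m u : 'rV[int]_n).

Definition ev m (v : 'cV[R]_n) : R := pairing (map_mx intr m) v.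

Lemma evD m1 m2 v : ev (m1 + m2) v = ev m1 v + ev m2 v.
Proof. by rewrite /ev /pairing map_mxD mulmxDl mxE. Qed.
Lemma ev0 v : ev 0 v = 0.
Proof. by rewrite /ev /pairing map_mx0 mul0mx mxE. Qed.
Lemma evN m v : ev (- m) v = - ev m v.
Proof. by rewrite /ev /pairing map_mxN mulNmx mxE. Qed.
Lemma evMn m v k : ev (m *+ k) v = ev m v *+ k.
Proof. by elim: k => [|k IH]; rewrite ?mulr0n ?ev0 // !mulrS evD IH. Qed.
Lemma ev_int m (v : 'cV[int]_n) : ev m (map_mx intr v) = ((m *m v) 0 0)%:~R.
Proof. by rewrite /ev /pairing -map_mxM mxE. Qed.

Definition orth s m : Prop := forall v, s v -> ev m v = 0.

Lemma dual0 s : dual_semigroup s 0.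
Proof. by move=> v _; rewrite -/(ev 0 v) ev0. Qed.
Lemma dualD s m1 m2 : dual_semigroup s m1 -> dual_semigroup s m2 ->
  dual_semigroup s (m1 + m2).
Proof. by move=> h1 h2 v sv; rewrite -/(ev _ v) evD addr_ge0 ?h1 ?h2. Qed.
Lemma dualMn s m k : dual_semigroup s m -> dual_semigroup s (m *+ k).
Proof. by move=> h v sv; rewrite -/(ev _ v) evMn mulrn_wge0 ?h. Qed.
Lemma dual_sub s t m : s `<=` t -> dual_semigroup t m -> dual_semigroup s m.
Proof. by move=> st h v /st; exact: h. Qed.
Lemma orth_dual s m : orth s m -> dual_semigroup s m.
Proof. by move=> h v sv; rewrite -/(ev _ v) h. Qed.
Lemma orth_dualN s m : orth s m -> dual_semigroup s (- m).
Proof. by move=> h v sv; rewrite -/(ev _ v) evN h ?oppr0. Qed.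

Section Generators.
Variables (s : set 'cV[R]_n) (r : nat) (g : 'I_r -> 'cV[int]_n).
Hypothesis hs : s = [set v | exists2 c : 'I_r -> R, (forall i, 0 <= c i) &
                 v = \sum_i c i *: map_mx intr (g i)].

Lemma gen_mem i : s (map_mx intr (g i)).
Proof.
rewrite hs; exists (fun j => (j == i)%:R) => [j|]; first by rewrite ler0n.
rewrite (bigD1 i) //= eqxx scale1r big1 ?addr0 // => j /negbTE ->.
by rewrite scale0r.
Qed.

Lemma pairing_sum (u : 'rV[R]_n) (c : 'I_r -> R) :
  pairing u (\sum_i c i *: map_mx intr (g i)) =
  \sum_i c i * pairing u (map_mx intr (g i)).
Proof.
rewrite /pairing mulmx_sumr summxE; apply: eq_bigr => i _.
by rewrite -scalemxAr mxE.
Qed.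

Lemma dual_gens m : dual_semigroup s m <-> forall i, 0 <= (m *m g i) 0 0.
Proof.
split=> [h i|h v]; first by rewrite -(ler0z R) -ev_int; apply: h; exact: gen_mem.
rewrite hs => -[c c0 ->]; rewrite pairing_sum; apply: sumr_ge0 => i _.
by rewrite mulr_ge0 // -/(ev _ _) ev_int ler0z.
Qed.

Lemma orth_gens m : orth s m <-> forall i, (m *m g i) 0 0 = 0.
Proof.
split=> [h i|h v].
  by apply/eqP; rewrite -(intr_eq0 R) -ev_int h //; exact: gen_mem.
rewrite hs => -[c c0 ->]; rewrite /ev pairing_sum big1 // => i _.
by rewrite -/(ev _ _) ev_int h mulr0.
Qed.

(** A form that is nonnegative on s vanishes at a nonnegative combination of
    the generators only if it vanishes at those that occur in it. *)
Lemma same_zeros (u w : 'rV[R]_n) :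
  (forall v, s v -> 0 <= pairing u v) -> (forall v, s v -> 0 <= pairing w v) ->
  (forall i, pairing u (map_mx intr (g i)) = 0 <-> pairing w (map_mx intr (g i)) = 0) ->
  s `&` [set v | pairing u v = 0] = s `&` [set v | pairing w v = 0].
Proof.
move=> u0 w0 uw.
have key (a b : 'rV[R]_n) : (forall v, s v -> 0 <= pairing a v) ->
  (forall i, pairing a (map_mx intr (g i)) = 0 -> pairing b (map_mx intr (g i)) = 0) ->
  s `&` [set v | pairing a v = 0] `<=` s `&` [set v | pairing b v = 0].
  move=> a0 ab v [sv /= av]; split => //=; move: sv av; rewrite hs => -[c c0 ->].
  rewrite !pairing_sum => /eqP; rewrite psumr_eq0 => [/allP h|i _]; last first.
    by rewrite mulr_ge0 // a0 //; exact: gen_mem.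
  apply: big1 => i _; have := h i (mem_index_enum _); rewrite /= mulf_eq0.
  by move=> /orP[/eqP ->|/eqP/ab ->]; rewrite ?mul0r ?mulr0.
by apply/seteqP; split; apply: key => // i; case: (uw i).
Qed.

(** By Farkas' lemma, if v were not in s, some form in the dual semigroup would
    be negative at v. *)
Lemma bidual (v : 'cV[int]_n) :
  (forall m, dual_semigroup s m -> 0 <= (m *m v) 0 0) -> s (map_mx intr v).
Proof.
move=> h; have [[c c0 vE]|[m /dual_gens/h mg mv]] := farkas_int R g v.
  by rewrite hs; exists c.
by move: mv; rewrite ltNge mg.
Qed.

(** The face is cut out by a real form u0. For each generator on which u0 does
    not vanish, Farkas' lemma gives an integral form of the dual semigroup
    positive on it and zero on the generators of the face; the sum of these
    forms cuts out the same face. *)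
Lemma face_cut_gens t : is_face t s -> exists2 u, dual_semigroup s u &
  t = s `&` [set v | ev u v = 0].
Proof.
move=> [u0 u0s tE].
pose G i : 'cV[R]_n := map_mx intr (g i).
have u0G i : 0 <= pairing u0 (G i) by apply: u0s; exact: gen_mem.
have /choice[f fP] : forall i, exists m : 'rV[int]_n, pairing u0 (G i) != 0 ->
   [/\ forall j, 0 <= (m *m g j) 0 0,
       forall j, pairing u0 (G j) = 0 -> (m *m g j) 0 0 = 0 & 0 < (m *m g i) 0 0].
  move=> i; have [_|ui] := eqVneq (pairing u0 (G i)) 0; first by exists 0.
  (* The opposites of the generators of the face force m to vanish on them. *)
  pose h (k : 'I_(r + r)) := match split k with inl j => g j
     | inr j => if pairing u0 (G j) == 0 then - g j else g j end.
  have u0h k : 0 <= pairing u0 (map_mx intr (h k)).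
    rewrite /h; case: split => j; first exact: u0G.
    case: eqP => uj; last exact: u0G.
    by rewrite map_mxN /pairing mulmxN mxE -/(pairing _ _) uj oppr0.
  have [[c c0 E]|[m mg mi]] := farkas_int R h (- g i).
    exfalso; have : pairing u0 (map_mx intr (- g i)) < 0.
      by rewrite map_mxN /pairing mulmxN mxE -/(pairing _ _) oppr_lt0 lt0r ui u0G.
    rewrite E /pairing mulmx_sumr summxE ltNge => /negP; apply.
    by apply: sumr_ge0 => k _; rewrite -scalemxAr mxE mulr_ge0 // -/(pairing _ _).
  exists m => _; split.
  - move=> j; have := mg (lshift r j).
    by rewrite /h -[lshift r j]/(unsplit (inl j)) unsplitK.
  - move=> j uj; apply/eqP; rewrite eq_le.
    have := mg (lshift r j); rewrite /h -[lshift r j]/(unsplit (inl j)) unsplitK => ->.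
    have := mg (rshift r j); rewrite /h -[rshift r j]/(unsplit (inr j)) unsplitK uj eqxx.
    by rewrite mulmxN mxE oppr_ge0 => ->.
  - by move: mi; rewrite mulmxN mxE oppr_lt0.
pose u := \sum_(i | pairing u0 (G i) != 0) f i.
have uE j : (u *m g j) 0 0 = \sum_(i | pairing u0 (G i) != 0) (f i *m g j) 0 0.
  by rewrite /u mulmx_suml summxE.
have ud : dual_semigroup s u.
  by apply/dual_gens => j; rewrite uE; apply: sumr_ge0 => i /fP[+ _ _]; apply.
exists u => //; rewrite tE; apply: same_zeros => // j.
rewrite -/(ev _ _) ev_int uE; split=> [uj|/eqP].
  by rewrite big1 // => i /fP[_ + _]; apply.
apply: contraTeq => uj; rewrite intr_eq0 (bigD1 j) //= gt_eqF //.
have [_ _ fj] := fP j uj; apply: ltr_wpDr fj.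
by apply: sumr_ge0 => i /andP[/fP[+ _ _] _]; apply.
Qed.

End Generators.

Lemma face_cut s t : rational_polyhedral s -> is_face t s ->
  exists2 u, dual_semigroup s u & t = s `&` [set v | ev u v = 0].
Proof. by move=> [r [g hs]]; exact: (face_cut_gens hs). Qed.

Lemma cut_face s u : dual_semigroup s u -> is_face (s `&` [set v | ev u v = 0]) s.
Proof. by move=> h; exists (map_mx intr u). Qed.

(** A form nonnegative on the face becomes nonnegative on s after adding a
    large multiple of u, since u is at least 1 on the generators outside the
    face. *)
Lemma cut_absorb s u m : rational_polyhedral s -> dual_semigroup s u ->
  dual_semigroup (s `&` [set v | ev u v = 0]) m ->
  exists k0, forall k, (k0 <= k)%N -> dual_semigroup s (m + u *+ k).
Proof.
move=> [r [g hs]] su hm.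
exists (\sum_i `|((m *m g i) 0 0)%R|)%N => k hk; apply/(dual_gens hs) => i.
have ui : 0 <= (u *m g i) 0 0 by have /(dual_gens hs) := su; apply.
rewrite -(ler0z R) -ev_int evD evMn.
have [u0|u0] := eqVneq ((u *m g i) 0 0) 0.
  rewrite !ev_int u0 mul0rn addr0 -ev_int; apply: hm; split; first exact: (gen_mem hs).
  by rewrite /= ev_int u0.
rewrite !ev_int (_ : _ + _ = ((m *m g i) 0 0 + (u *m g i) 0 0 *+ k)%:~R); last first.
  by rewrite rmorphD rmorphMn.
rewrite ler0z.
have hk' : (`|((m *m g i) 0 0)%R| <= k)%N.
  by apply: leq_trans hk; rewrite (bigD1 i) //= leq_addr.
have := ui; move: (m *m g i) (u *m g i) u0 hk' => a b; move: (a 0 0) (b 0 0) => {}a {}b.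
rewrite -mulr_natr; nia.
Qed.

End Cones.

(** * Points of a chart *)

Section Charts.
Variables (R : realType) (n : nat).
Implicit Types (s t : set 'cV[R]_n) (m u : 'rV[int]_n).

Lemma chart_ext s (x y : chart s) : x =1 y -> x = y.
Proof.
case: x y => [x x0 xD xo] [y y0 yD yo] /= /funext E.
by subst y; congr Chart; exact: Prop_irrelevance.
Qed.

Lemma chart_valMn s (x : chart s) m k : dual_semigroup s m -> x (m *+ k) = x m ^+ k.
Proof.
move=> hm; elim: k => [|k IH]; first by rewrite mulr0n expr0 chart_val0.
by rewrite mulrS exprS chart_valD ?IH //; exact: dualMn.
Qed.

Lemma chart_val_sum s (x : chart s) r (f : 'I_r -> 'rV[int]_n) :
  (forall i, dual_semigroup s (f i)) ->
  dual_semigroup s (\sum_i f i) /\ x (\sum_i f i) = \prod_i x (f i).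
Proof.
elim: r f => [|r IH] f hf.
  by rewrite !big_ord0 chart_val0; split => //; exact: dual0.
have [h1 h2] := IH (fun i => f (lift ord0 i)) (fun i => hf _).
rewrite !big_ord_recl; split; first exact: dualD.
by rewrite chart_valD // h2.
Qed.

(** A smaller cone has a larger dual semigroup, hence this is the map from the
    open chart of t to the chart of s. *)
Lemma chart_restrict s t (y : chart t) : t `<=` s ->
  exists z : chart s, forall m, dual_semigroup s m -> z m = y m.
Proof.
move=> ts; pose f m := if `[< dual_semigroup s m >] then y m else 0.
have f0 : f 0 = 1 by rewrite /f asboolT ?chart_val0 //; exact: dual0.
have fD m1 m2 : dual_semigroup s m1 -> dual_semigroup s m2 -> f (m1 + m2) = f m1 * f m2.
  move=> h1 h2; rewrite /f !asboolT // ?chart_valD //; last exact: dualD.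
    exact: dual_sub h1.
  exact: dual_sub h2.
have fo m : ~ dual_semigroup s m -> f m = 0 by move=> h; rewrite /f asboolF.
by exists (Chart f0 fD fo) => m hm /=; rewrite /f asboolT.
Qed.

(** The cone of the torus orbit of x; [support_cut] shows that it is a face of
    s. *)
Definition support_cone s (x : chart s) : set 'cV[R]_n :=
  [set v | s v /\ forall m, dual_semigroup s m -> x m != 0 -> ev m v = 0].

(** The relation x(m) = c, extended to those m in M at which x, as a rational
    character, is defined. *)
Definition ratio s (x : chart s) m (c : R[i]) : Prop :=
  exists a, [/\ dual_semigroup s a, x a != 0, dual_semigroup s (m + a) &
                x (m + a) = c * x a].

(** For each generator choose a character that is nonzero at x and, if
    possible, positive on this generator; the sum of these characters cuts out
    the support cone. *)
Lemma support_cut s (x : chart s) : rational_polyhedral s ->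
  exists u, [/\ dual_semigroup s u, x u != 0 &
    support_cone x = s `&` [set v | ev u v = 0]].
Proof.
move=> [r [g hs]].
have /choice[f fP] : forall i, exists m, [/\ dual_semigroup s m, x m != 0 &
    (m *m g i) 0 0 = 0 -> forall m', dual_semigroup s m' -> x m' != 0 ->
    (m' *m g i) 0 0 = 0].
  move=> i; have [[m [h1 h2 h3]]|no] := pselect (exists m,
    [/\ dual_semigroup s m, x m != 0 & (m *m g i) 0 0 <> 0]); first by exists m.
  exists 0; split; first exact: dual0.
    by rewrite chart_val0 oner_neq0.
  move=> _ m' h1 h2; apply: contrapT => h3; apply: no; by exists m'.
have fd i : dual_semigroup s (f i) by case: (fP i).
have [su xu] := chart_val_sum x fd.
exists (\sum_i f i); have xu0 : x (\sum_i f i) != 0.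
  by rewrite xu; apply/prodf_neq0 => i _; case: (fP i).
split => //; apply/seteqP; split=> v [sv hv]; split => //=; first exact: hv.
move=> m hm xm; move: sv hv; rewrite {1}hs => -[c c0 ->] /=.
rewrite /ev !pairing_sum => /eqP; rewrite psumr_eq0 => [/allP h|i _]; last first.
  by rewrite mulr_ge0 //; apply: su; exact: gen_mem hs i.
apply: big1 => i _; have := h i (mem_index_enum _); rewrite /= mulf_eq0.
move=> /orP[/eqP ->|]; first by rewrite mul0r.
rewrite -!/(ev _ _) !ev_int intr_eq0 mulmx_suml summxE psumr_eq0 => [|j _]; last first.
  by have /(dual_gens hs) := fd j; apply.
move=> /allP/(_ i (mem_index_enum _)) /= /eqP fi.
by have [_ _ h'] := fP i; rewrite (h' fi) ?mulr0.
Qed.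

(** If m is orthogonal to the support cone, then - m + k u is in the dual
    semigroup for large k, so that x(m) divides x(u)^k. *)
Lemma support_val s (x : chart s) m : rational_polyhedral s -> dual_semigroup s m ->
  x m != 0 <-> orth (support_cone x) m.
Proof.
move=> hs hm; split=> [xm v [_]|]; first exact.
have [u [su xu ->]] := support_cut x hs => ho.
have [k0 /(_ k0 (leqnn _)) hk] := cut_absorb hs su (orth_dualN ho).
have : x (m + (- m + u *+ k0)) != 0.
  by rewrite addrA subrr add0r chart_valMn ?expf_neq0.
by rewrite chart_valD // mulf_eq0 negb_or => /andP[].
Qed.

(** The point x lies in the principal open subset where chi^u is invertible:
    put y(m) = x(m + k u) / x(u)^k. *)
Lemma localise s u (x : chart s) : rational_polyhedral s ->
  dual_semigroup s u -> x u != 0 ->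
  exists y : chart (s `&` [set v | ev u v = 0]),
    forall m, dual_semigroup s m -> y m = x m.
Proof.
move=> hs su xu; set t := s `&` _.
have st m : dual_semigroup s m -> dual_semigroup t m by apply: dual_sub => v [].
have /choice[K KP] : forall m, exists k, dual_semigroup t m -> dual_semigroup s (m + u *+ k).
  move=> m; have [h|] := pselect (dual_semigroup t m); last by exists 0%N.
  by have [k0 hk] := cut_absorb hs su h; exists k0 => _; exact: hk.
pose f m := if `[< dual_semigroup t m >] then x (m + u *+ K m) / x u ^+ K m else 0.
have fE m k : dual_semigroup t m -> dual_semigroup s (m + u *+ k) ->
    f m = x (m + u *+ k) / x u ^+ k.
  move=> tm hk; rewrite /f asboolT //; apply/eqP.
  rewrite eqr_div ?expf_neq0 // -!chart_valMn //.
  rewrite -(chart_valD x hk (dualMn (K m) su)) -(chart_valD x (KP m tm) (dualMn k su)).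
  by rewrite -!addrA [u *+ k + _]addrC.
have f0 : f 0 = 1.
  by rewrite (fE 0 0%N) ?mulr0n ?addr0 ?chart_val0 ?divr1 //; exact: dual0.
have fD m1 m2 : dual_semigroup t m1 -> dual_semigroup t m2 -> f (m1 + m2) = f m1 * f m2.
  move=> h1 h2; have E : m1 + m2 + u *+ (K m1 + K m2) = (m1 + u *+ K m1) + (m2 + u *+ K m2).
    by rewrite mulrnDr addrACA.
  have h12 : dual_semigroup s (m1 + m2 + u *+ (K m1 + K m2)).
    by rewrite E; apply: dualD; exact: KP.
  rewrite (fE _ _ (dualD h1 h2) h12) E chart_valD; try exact: KP.
  by rewrite exprD -mulf_div /f !asboolT.
have fo m : ~ dual_semigroup t m -> f m = 0 by move=> h; rewrite /f asboolF.
exists (Chart f0 fD fo) => m hm /=.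
by rewrite (fE m 0%N) ?mulr0n ?addr0 ?divr1 //; exact: st.
Qed.

Lemma ratio_fun s (x : chart s) m c c' : ratio x m c -> ratio x m c' -> c = c'.
Proof.
move=> [a [sa xa sma E]] [b [sb xb smb E']].
have : x (m + a) * x b = x (m + b) * x a.
  by rewrite -!chart_valD // -!addrA [a + b]addrC.
rewrite E E' -!mulrA [x b * _]mulrC => /mulIf; apply.
by rewrite mulf_neq0.
Qed.

Lemma ratio_val s (x : chart s) m : dual_semigroup s m -> ratio x m (x m).
Proof.
move=> sm; exists 0; rewrite addr0 chart_val0 mulr1; split => //; first exact: dual0.
exact: oner_neq0.
Qed.

(** The support cone and the rational character of a point do not change when
    it is read in the chart of a face.  They are therefore constant along
    [glued], which is how points of different charts are compared. *)
Lemma localise_invariants s t u (x : chart s) (y : chart t) :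
  rational_polyhedral s -> dual_semigroup s u -> t = s `&` [set v | ev u v = 0] ->
  (forall m, dual_semigroup s m -> x m = y m) ->
  support_cone x = support_cone y /\ forall m c, ratio x m c <-> ratio y m c.
Proof.
move=> hs su tE xy.
have ts : t `<=` s by rewrite tE => v [].
have st m : dual_semigroup s m -> dual_semigroup t m by exact: dual_sub.
have ou : orth t u by rewrite tE => v [].
have yu : y u != 0.
  have := chart_valD y (st _ su) (orth_dualN ou); rewrite subrr chart_val0 => /esym E.
  by apply: contra_eq_neq E => ->; rewrite mul0r eq_sym oner_neq0.
have absorb m : dual_semigroup t m ->
    exists k0, forall k, (k0 <= k)%N -> dual_semigroup s (m + u *+ k).
  by rewrite tE; exact: cut_absorb.
have yD m k : dual_semigroup t m -> y (m + u *+ k) = y m * y u ^+ k.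
  by move=> tm; rewrite chart_valD ?chart_valMn //; [exact: st | apply: dualMn; exact: st].
split.
- apply/seteqP; split=> v [hv hx]; split.
  + by rewrite tE; split => //=; apply: hx => //; rewrite xy.
  + move=> m tm ym; have [k0 /(_ _ (leqnn _)) hk] := absorb m tm.
    have := hx _ hk; rewrite xy // yD // mulf_neq0 ?expf_neq0 // => /(_ isT).
    by rewrite evD evMn (hx u su) ?mul0rn ?addr0 // xy.
  + exact: ts.
  + by move=> m sm xm; apply: hx; [exact: st | rewrite -xy].
- move=> m c; split=> -[a [ha xa hma E]].
  + by exists a; split; rewrite -?xy //; exact: st.
  + have [k0 hk0] := absorb a ha; have [k1 hk1] := absorb _ hma.
    pose k := maxn k0 k1; have h0 := hk0 k (leq_maxl _ _); have h1 := hk1 k (leq_maxr _ _).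
    exists (a + u *+ k); split => //; rewrite ?addrA // !xy // !yD //.
      by rewrite mulf_neq0 ?expf_neq0.
    by rewrite E mulrA.
Qed.

End Charts.

(** * Gluing of charts *)

Section Variety.
Variables (R : realType) (n : nat) (D : fan R n).
Implicit Types (s t : set 'cV[R]_n) (m u : 'rV[int]_n).

Lemma glued_invariants (p q : chart_point D) : glued p q ->
  support_cone (cp_val p) = support_cone (cp_val q) /\
  forall m c, ratio (cp_val p) m c <-> ratio (cp_val q) m c.
Proof.
case: p q => [s hs x] [t ht x'] [y /= [xy x'y]].
have [f1 f2] := cones_meet hs ht.
have [u su uE] := face_cut (cones_rational hs) f1.
have [u' su' uE'] := face_cut (cones_rational ht) f2.
have xy' m : dual_semigroup s m -> x m = y m by move=> hm; apply: xy; rewrite inE.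
have x'y' m : dual_semigroup t m -> x' m = y m by move=> hm; apply: x'y; rewrite inE.
have [-> e1] := localise_invariants (cones_rational hs) su uE xy'.
have [-> e2] := localise_invariants (cones_rational ht) su' uE' x'y'.
by split=> // m c; rewrite e1 e2.
Qed.

Lemma of_chart_invariants s t (hs : cones D s) (ht : cones D t) x y :
  of_chart hs x = of_chart ht y ->
  support_cone x = support_cone y /\ forall m c, ratio x m c <-> ratio y m c.
Proof.
move/eqmodP/asboolP.
suff key p q : Relation_Operators.clos_refl_sym_trans _ (@glued R n D) p q ->
  support_cone (cp_val p) = support_cone (cp_val q) /\
  forall m c, ratio (cp_val p) m c <-> ratio (cp_val q) m c by exact: key.
elim=> {p q} [p q|p|p q _ [-> e]|p q r _ [-> e1] _ [-> e2]] //.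
- exact: glued_invariants.
- by split=> // m c; rewrite e.
- by split=> // m c; rewrite e1 e2.
Qed.

Lemma of_chart_val s t (hs : cones D s) (ht : cones D t) x y m :
  of_chart hs x = of_chart ht y -> dual_semigroup s m -> dual_semigroup t m ->
  x m = y m.
Proof.
move=> /of_chart_invariants[_ e] sm tm; have := ratio_val y tm.
rewrite -e; exact: ratio_fun (ratio_val x sm).
Qed.

(** The values of x are recovered from [ratio], which is constant on the
    classes of the equivalence relation generated by [glued]. *)
Lemma of_chart_inj s (hs : cones D s) : injective (@of_chart R n D s hs).
Proof.
move=> x y e; apply: chart_ext => m.
have [sm|sm] := pselect (dual_semigroup s m); first exact: (of_chart_val e sm sm).
by rewrite !chart_val_out.
Qed.

Lemma glue s t (hs : cones D s) (ht : cones D t) (x : chart s) (y : chart t)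
    (z : chart (s `&` t)) :
  (forall m, dual_semigroup s m -> x m = z m) ->
  (forall m, dual_semigroup t m -> y m = z m) ->
  of_chart hs x = of_chart ht y.
Proof.
move=> xz yz; apply/eqmodP/asboolP/rst_step; exists z.
by split=> m; rewrite inE => ?; [exact: xz | exact: yz].
Qed.

(** The point lies in the closed torus orbit of the chart of s. *)
Definition central s (x : chart s) : Prop :=
  forall m, dual_semigroup s m -> x m != 0 <-> orth s m.

(** Localise along the support cone. *)
Lemma exists_central (P : toric_variety D) :
  exists (s : set 'cV[R]_n) (hs : cones D s) (x : chart s),
    P = of_chart hs x /\ central x.
Proof.
have [s [hs [x ->]]] : exists s (hs : cones D s) x, P = of_chart hs x.
  rewrite -[P]reprK; case: (repr P) => s hs x.
  by exists s, hs, x.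
have rs := cones_rational hs.
have [u [su xu sE]] := support_cut x rs.
have ht := cones_face hs (cut_face su).
have [y yx] := localise rs su xu.
set t := s `&` _ in ht y yx.
have [e _] := localise_invariants rs su erefl (fun m sm => esym (yx m sm)).
exists t, ht, y; split.
  have tst : t `<=` s `&` t by move=> v tv; split => //; case: tv.
  have [z zy] := chart_restrict y tst.
  apply: (glue hs ht (z := z)) => m sm; last by rewrite zy //; apply: dual_sub sm => v [].
  by rewrite zy ?yx //; apply: dual_sub sm => v [].
by move=> m tm; rewrite (support_val y (cones_rational ht) tm) -e sE.
Qed.

(** In the chart of s, the chart of t is the principal open subset chi^u <> 0,
    where u cuts out the common face of s and t. *)
Lemma chart_open t (ht : cones D t) : zariski_open (range (@of_chart R n D t ht)).
Proof.
move=> s hs; have rs := cones_rational hs.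
have [f1 _] := cones_meet hs ht; have [u su uE] := face_cut rs f1.
exists [set fun x : chart s => x u].
  move=> _ ->; exists [:: (1, u)] => [m|x]; first by rewrite inE => /eqP ->.
  by rewrite big_seq1 mul1r.
move=> x; suff key : range (@of_chart R n D t ht) (of_chart hs x) <-> x u != 0.
  split=> [h _ ->|/(_ _ erefl) xu /key]; last by rewrite xu eqxx.
  by apply/eqP; apply: contrapT => /negP/key.
split=> [[y _ /of_chart_invariants[e _]]|xu].
  rewrite (support_val x rs su) -e => v.
  have : support_cone y `<=` s `&` t by move=> w hw; split; [have := hw; rewrite e => -[] | case: hw].
  by move=> h /h; rewrite uE => -[].
have [z zx] := localise rs su xu.
move: z zx; rewrite -uE => z zx.
have [|y yz] := chart_restrict z (s := t); first by move=> v [].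
exists y => //; apply/esym/(glue hs ht (z := z)) => m hm; first by rewrite zx.
by rewrite yz.
Qed.

End Variety.

(** * Characters of the torus *)

Section Independence.
Variables (R : realType) (n : nat).

Definition chi (m : 'rV[int]_n) (t : torus R n) : R[i] := \prod_j t j ^ m 0 j.

Lemma torusM_neq0 (t t' : torus R n) i : t i * t' i != 0.
Proof. by rewrite mulf_neq0 ?torus_neq0. Qed.

Definition torusM (t t' : torus R n) := Torus (torusM_neq0 t t').

Lemma chiM m t t' : chi m (torusM t t') = chi m t * chi m t'.
Proof. by rewrite /chi -big_split; apply: eq_bigr => j _; rewrite /= expfzMl. Qed.

Lemma chiD m1 m2 t : chi (m1 + m2) t = chi m1 t * chi m2 t.
Proof.
by rewrite /chi -big_split; apply: eq_bigr => j _; rewrite mxE expfzDr ?torus_neq0.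
Qed.

Lemma chi_neq0 m t : chi m t != 0.
Proof. exact: (monomial_neq0 (fun j => m 0 j)). Qed.

Lemma delta_neq0 (j i : 'I_n) : (if i == j then 2%:R else 1 : R[i]) != 0.
Proof. by case: ifP => _; rewrite ?pnatr_eq0 ?oner_neq0. Qed.

Lemma pow2_eq1 (c : int) : (2%:R : R[i]) ^ c = 1 -> c = 0.
Proof.
have nat_case k : (2%:R : R[i]) ^+ k = 1 -> k = 0%N.
  move=> /eqP; rewrite -natrX pnatr_eq1 => /eqP; case: k => // k.
  by rewrite expnS; lia.
case: c => k; first by move=> /nat_case ->.
rewrite NegzE -exprnN => /eqP; rewrite invr_eq1 => /eqP /nat_case //.
Qed.

Lemma chi_separates (m m' : 'rV[int]_n) : m != m' -> exists t, chi m t != chi m' t.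
Proof.
move=> mm'; have [j mj] : exists j, m 0 j != m' 0 j.
  apply: contrapT => no; move/eqP: mm'; apply; apply/matrixP => i j; rewrite ord1.
  by apply: contrapT => h; apply: no; exists j; apply/eqP.
exists (Torus (delta_neq0 j)).
have E e : chi e (Torus (delta_neq0 j)) = 2%:R ^ e 0 j.
  rewrite /chi (bigD1 j) //= eqxx big1 ?mulr1 // => i /negbTE ->.
  by rewrite exp1rz.
rewrite !E; apply: contraNneq mj; move: (m 0 j) (m' 0 j) => a b ab.
have : (2%:R : R[i]) ^ (a - b) = 1.
  by rewrite expfzDr ?pnatr_eq0 // ab -expfzDr ?pnatr_eq0 // subrr expr0z.
by move=> /pow2_eq1/eqP; rewrite subr_eq0.
Qed.

(** Artin's argument: multiplying the relation by chi^e0(t0) and comparing it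
    with its translate by t0 eliminates e0. *)
Lemma chi_independent (es : seq 'rV[int]_n) (k : 'rV[int]_n -> R[i]) : uniq es ->
  (forall t, \sum_(e <- es) k e * chi e t = 0) -> forall e, e \in es -> k e = 0.
Proof.
elim: es k => [//|e0 es IH] k /= /andP[e0es ues] h.
have hes e : e \in es -> k e = 0.
  move=> ees; have ne : e != e0 by apply: contraNneq e0es => <-.
  have [t0 ht0] := chi_separates ne.
  have /eqP : k e * (chi e t0 - chi e0 t0) = 0.
    apply: (IH (fun e => k e * (chi e t0 - chi e0 t0))) => // t.
    have h1 := h t; have h2 := h (torusM t0 t); rewrite !big_cons in h1 h2.
    set a := \sum_(e <- es) k e * chi e (torusM t0 t) in h2.
    set b := \sum_(e <- es) k e * chi e t in h1.
    have -> : \sum_(e <- es) k e * (chi e t0 - chi e0 t0) * chi e t = a - chi e0 t0 * b.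
      by rewrite /a /b mulr_sumr -sumrB; apply: eq_bigr => i _; rewrite chiM; ring.
    have -> : a - chi e0 t0 * b = (k e0 * chi e0 (torusM t0 t) + a) -
        chi e0 t0 * (k e0 * chi e0 t + b) by rewrite chiM; ring.
    by rewrite h1 h2 mulr0 subrr.
  by rewrite mulf_eq0 subr_eq0 (negbTE ht0) orbF => /eqP.
move=> e; rewrite inE => /orP[/eqP ->|/hes //].
have := h (Torus (fun i => oner_neq0 R[i])); rewrite big_cons big_seq big1 => [|x /hes ->]; last first.
  by rewrite mul0r.
by rewrite addr0 => /eqP; rewrite mulf_eq0 (negbTE (chi_neq0 _ _)) orbF => /eqP.
Qed.

(** Once equal exponents are grouped all coefficients vanish, so that the
    characters may be replaced by arbitrary numbers phi(m). *)
Lemma torus_independent (l : seq (R[i] * 'rV[int]_n)) :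
  (forall t, \sum_(x <- l) x.1 * chi x.2 t = 0) ->
  forall phi : 'rV[int]_n -> R[i], \sum_(x <- l) x.1 * phi x.2 = 0.
Proof.
move=> h phi; pose es := undup [seq x.2 | x <- l].
pose k e := \sum_(x <- l | x.2 == e) x.1.
have E (f : 'rV[int]_n -> R[i]) : \sum_(x <- l) x.1 * f x.2 = \sum_(e <- es) k e * f e.
  transitivity (\sum_(e <- es) \sum_(x <- l | x.2 == e) x.1 * f x.2).
    rewrite (exchange_big_dep xpredT) //= big_seq [RHS]big_seq.
    apply: eq_bigr => x xl; under eq_bigl => e do rewrite eq_sym.
    rewrite -big_filter filter_pred1_uniq ?big_seq1 ?undup_uniq //.
    by rewrite mem_undup map_f.
  by apply: eq_bigr => e _; rewrite mulr_suml; apply: eq_bigr => x /eqP ->.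
rewrite E big_seq big1 // => e ees.
have -> : k e = 0; last by rewrite mul0r.
by apply: (chi_independent (undup_uniq _)) ees => t; rewrite -E.
Qed.

Lemma chi_torus_map (A : 'M[int]_n) m t : chi m (torus_map A t) = chi (m *m A) t.
Proof.
rewrite /chi /=; under eq_bigr => i _.
  rewrite (big_morph _ (fun a b => expfzMl a b (m 0 i)) (exp1rz _ (m 0 i))).
  under eq_bigr => j _ do rewrite exprz_exp.
  over.
rewrite exchange_big; apply: eq_bigr => j _.
rewrite mxE (big_morph _ (fun a b => expfzDr a b (torus_neq0 t j)) (expr0z (t j))).
by apply: eq_bigr => i _; rewrite mulrC.
Qed.

Lemma torus_chartE s (t : torus R n) m : dual_semigroup s m ->
  torus_chart s t m = chi m t.
Proof. by move=> h; rewrite /= /torus_chart_val asboolT. Qed.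

End Independence.

(** * Extensions of monomial maps *)

Section Extension.
Variables (R : realType) (n : nat) (D : fan R n) (A : 'M[int]_n).

Lemma coord_ring_chi (s : set 'cV[R]_n) m : dual_semigroup s m ->
  coord_ring (fun x : chart s => x m).
Proof.
move=> h; exists [:: (1, m)] => [z|x]; first by rewrite inE => /eqP ->.
by rewrite big_seq1 mul1r.
Qed.

Lemma coord_ring1 (s : set 'cV[R]_n) : coord_ring (fun x : chart s => 1).
Proof.
have := coord_ring_chi (@dual0 R n s); congr coord_ring.
by apply/funext => x; rewrite chart_val0.
Qed.

(** The function chi^m is regular on the chart of t, so that its pull-back is
    regular at P, equal to g / h in the chart of some cone s'. On the torus
    this says h chi^(mA) = g near P, and everywhere on the torus once both
    sides are multiplied by an element F of the coordinate ring that is nonzero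
    at P and vanishes outside the neighbourhood.  By independence of characters
    this is an identity of Laurent polynomials.  As F h does not vanish at P,
    it has a term chi^a with a orthogonal to s such that a + mA occurs in F g;
    hence mA lies in S_s, and evaluating the identity at P gives the value. *)
Lemma extends_at_val P Q (s t : set 'cV[R]_n) (hs : cones D s) (ht : cones D t)
    (x : chart s) (y : chart t) m :
  extends_at A P Q -> P = of_chart hs x -> central x -> Q = of_chart ht y ->
  dual_semigroup t m -> dual_semigroup s (m *m A) /\ y m = x (m *m A).
Proof.
move=> [V [psi [VP [oV _ rV] psiT psiP]]] Px cx Qy tm.
pose W := range (@of_chart R n D t ht).
have oW : open W := chart_open ht.
pose f (Z : toric_variety D) : R[i] :=
  xget 0 [set c | exists2 z, Z = of_chart ht z & c = z m].
have fE z : f (of_chart ht z) = z m.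
  have : [set c | exists2 z', of_chart ht z = of_chart ht z' & c = z' m] (f (of_chart ht z)).
    by apply: xgetPex; exists (z m), z.
  by move=> [z' /of_chart_inj <- ->].
have regf : regular_on W f.
  move=> _ [z _ <-]; exists t, ht, (fun z => z m), (fun=> 1), W; split => //.
  - exact: coord_ring_chi.
  - exact: coord_ring1.
  - by split=> //; exists z.
  - by move=> _ [z' _ <-]; exists z'; rewrite fE oner_neq0 divr1.
have WQ : W (psi P) by rewrite psiP Qy; exists y.
have [s' [hs' [g [h [W' [cg ch [oW' W'P] sub H]]]]]] := rV W f oW regf P (conj VP WQ).
have [xP [PxP hxP fP]] := H P W'P.
have [I hI IE] := oW' s' hs'.
have [F IF FxP] : exists2 F, I F & F xP != 0.
  apply: contrapT => no; have : ~ W' (of_chart hs' xP).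
    by apply/IE => F IF; apply: contrapT => /eqP F0; apply: no; exists F.
  by rewrite -PxP.
have [l hl lE] := coord_ringM (hI F IF) ch.
have [l' hl' l'E] := coord_ringM (hI F IF) cg.
pose mA := m *m A.
have ident tt : \sum_(z <- l) z.1 * chi (z.2 + mA) tt = \sum_(z <- l') z.1 * chi z.2 tt.
  pose T := torus_chart s' tt.
  have e1 : \sum_(z <- l) z.1 * chi (z.2 + mA) tt = F T * h T * chi mA tt.
    rewrite lE mulr_suml big_seq [RHS]big_seq; apply: eq_bigr => z zl.
    by rewrite (torus_chartE _ (hl _ zl)) (chiD z.2 mA) mulrA.
  have e2 : \sum_(z <- l') z.1 * chi z.2 tt = F T * g T.
    rewrite l'E big_seq [RHS]big_seq; apply: eq_bigr => z zl.
    by rewrite (torus_chartE _ (hl' _ zl)).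
  rewrite e1 e2; have [->|FT] := eqVneq (F T) 0; first by rewrite !mul0r.
  have W'T : W' (of_chart hs' T).
    by apply: contrapT => /IE/(_ F IF)/eqP; rewrite (negbTE FT).
  have [z [/of_chart_inj <- hT]] := H _ W'T.
  have [VT _] := sub _ W'T.
  have TE : of_torus D tt = of_chart hs' T := of_torusE hs' tt.
  rewrite /= -TE psiT ?TE // (of_torusE ht) fE torus_chartE // chi_torus_map => ->.
  by rewrite -mulrA; congr (_ * _); rewrite mulrC divfK.
have univ phi : \sum_(z <- l) z.1 * phi (z.2 + mA) = \sum_(z <- l') z.1 * phi z.2.
  have := torus_independent (l := [seq (z.1, z.2 + mA) | z <- l] ++ [seq (- z.1, z.2) | z <- l']).
  have E (ph : 'rV[int]_n -> R[i]) : \sum_(z <- [seq (z.1, z.2 + mA) | z <- l] ++ [seq (- z.1, z.2) | z <- l'])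
      z.1 * ph z.2 = \sum_(z <- l) z.1 * ph (z.2 + mA) - \sum_(z <- l') z.1 * ph z.2.
    rewrite big_cat !big_map /= -sumrN; congr (_ + _).
    by apply: eq_bigr => z _; rewrite mulNr.
  move=> /(_ _ phi); rewrite E => h0; apply/eqP; rewrite -subr_eq0; apply/eqP/h0 => tt.
  by rewrite (E (fun e => chi e tt)) ident subrr.
have ex : of_chart hs x = of_chart hs' xP by rewrite -Px.
have ss' : s `<=` s'.
  move=> v sv; have : support_cone x v.
    by split=> // e se xe; exact: ((cx e se).1 xe v sv).
  by have [-> _] := of_chart_invariants ex; case.
have dss e : dual_semigroup s' e -> dual_semigroup s e by exact: dual_sub.
have xE e : dual_semigroup s' e -> xP e = x e.
  by move=> se; apply/esym/(of_chart_val ex) => //; exact: dss.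
have FhE : F xP * h xP = \sum_(z <- l) z.1 * x z.2.
  by rewrite lE big_seq [RHS]big_seq; apply: eq_bigr => z zl; rewrite (xE _ (hl _ zl)).
have FgE : F xP * g xP = \sum_(z <- l') z.1 * x z.2.
  by rewrite l'E big_seq [RHS]big_seq; apply: eq_bigr => z zl; rewrite (xE _ (hl' _ zl)).
have Fh0 : F xP * h xP != 0 by rewrite mulf_neq0.
have [z zl [xz sz]] : exists2 z, z \in l & x z.2 != 0 /\ dual_semigroup s' (z.2 + mA).
  apply: contrapT => no; move/eqP: Fh0; apply; rewrite FhE.
  (* These values kill all terms of F g but, if there is no such z, none of the
     terms of F h that are nonzero at P. *)
  pose phi e := if `[< dual_semigroup s' e >] then 0 else x (e - mA).
  transitivity (\sum_(z <- l) z.1 * phi (z.2 + mA)).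
    rewrite big_seq [RHS]big_seq; apply: eq_bigr => z zl; congr (_ * _).
    rewrite /phi addrK; case: asboolP => // sz; apply: contrapT => /eqP xz.
    by apply: no; exists z.
  rewrite univ big_seq big1 // => z zl.
  by rewrite /phi asboolT ?mulr0 //; exact: hl'.
have smA : dual_semigroup s mA.
  have oz : orth s z.2 by exact: ((cx _ (dss _ (hl _ zl))).1 xz).
  have -> : mA = (z.2 + mA) + - z.2 by rewrite addrC addKr.
  by apply: dualD; [exact: dss | exact: orth_dualN].
split => //; have := univ x; rewrite -FgE.
have -> : \sum_(z <- l) z.1 * x (z.2 + mA) = F xP * h xP * x mA.
  rewrite FhE mulr_suml big_seq [RHS]big_seq; apply: eq_bigr => w wl.
  by rewrite (chart_valD x (dss _ (hl _ wl)) smA) mulrA.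
rewrite -mulrA => /(mulfI FxP) E.
rewrite -fE -Qy -psiP; move: fP => /= ->.
by rewrite -E mulrC mulKf.
Qed.

End Extension.

(** * The cones along an orbit *)

Section Transition.
Variables (R : realType) (n : nat) (D : fan R n) (A : 'M[int]_n).
Implicit Types (s t : set 'cV[R]_n) (m u : 'rV[int]_n).

(** The dual form of: A maps the relative interior of s into that of t. *)
Definition transition s t : Prop := forall m, dual_semigroup t m ->
  dual_semigroup s (m *m A) /\ (orth t m <-> orth s (m *m A)).

(** Let w be the sum of the generators of s.  By biduality A w lies in t1 and
    in t2, hence in their common face, cut out in t1 by u say.  Then uA is
    nonnegative on s and zero at w, so that it is orthogonal to s; hence u is
    orthogonal to t1, which means that t1 is contained in t2. *)
Lemma transition_unique s t t' : cones D s -> cones D t -> cones D t' ->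
  transition s t -> transition s t' -> t = t'.
Proof.
suff key t1 t2 : cones D s -> cones D t1 -> cones D t2 ->
    transition s t1 -> transition s t2 -> t1 `<=` t2.
  by move=> hs ht ht' h h'; apply/seteqP; split; exact: key.
move=> hs ht1 ht2 tr1 tr2.
have [r [g sE]] := cones_rational hs.
pose w := \sum_i g i.
have wE m : (m *m (A *m w)) 0 0 = \sum_i ((m *m A) *m g i) 0 0.
  by rewrite mulmxA mulmx_sumr summxE.
have Aw_mem t0 : cones D t0 -> transition s t0 -> t0 (map_mx intr (A *m w)).
  move=> ht0 tr; have [r' [g' tE]] := cones_rational ht0.
  apply: (bidual tE) => m /tr[/(dual_gens sE) h _].
  by rewrite wE; apply: sumr_ge0.
have [f1 _] := cones_meet ht1 ht2.
have [u tu uE] := face_cut (cones_rational ht1) f1.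
have : (t1 `&` t2) (map_mx intr (A *m w)) by split; exact: Aw_mem.
rewrite uE => -[_ /= /eqP]; rewrite ev_int intr_eq0 wE.
have [/(dual_gens sE) suA ou] := tr1 u tu.
rewrite psumr_eq0 => [/allP h|i _]; last exact: suA.
have /ou ot : orth s (u *m A).
  by apply/(orth_gens sE) => i; have /eqP := h i (mem_index_enum _).
by move=> v tv; have [] : (t1 `&` t2) v by rewrite uE; split => //; exact: ot.
Qed.

(** The forms orthogonal to s are the left kernel of an integral matrix; by the
    Smith normal form this is a direct factor of M. *)
Lemma orth_retract s : rational_polyhedral s -> exists pi : 'M[int]_n,
  (forall m, orth s (m *m pi)) /\ (forall m, orth s m -> m *m pi = m).
Proof.
move=> [r [g sE]].
pose G : 'M[int]_(n, r) := \matrix_(a, i) g i a 0.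
have orthG m : orth s m <-> m *m G = 0.
  have E i : (m *m G) 0 i = (m *m g i) 0 0.
    by rewrite !mxE; apply: eq_bigr => a _; rewrite mxE.
  rewrite (orth_gens sE); split=> [h|h i]; last by rewrite -E h mxE.
  by apply/matrixP => a i; rewrite ord1 E h mxE.
have [L uL [Q uQ [d _ GE]]] := int_Smith_normal_form G.
set Dm := (\matrix_(i, j) _) in GE.
(* In the basis given by L, the kernel is spanned by the basis vectors that
   correspond to the zero rows of the diagonal matrix. *)
pose E : 'M[int]_n := \matrix_(i, j) ((i == j) && (row i Dm == 0))%:R.
have ED : E *m Dm = 0.
  apply/matrixP => i j; rewrite mxE (bigD1 i) //= big1 ?addr0 => [|k ki]; last first.
    by rewrite mxE eq_sym (negbTE ki) mul0r.
  rewrite [E i i]mxE eqxx /=; case: eqP => [|_]; last by rewrite mul0r mxE.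
  by move=> /matrixP/(_ 0 j); rewrite !mxE mul1r.
exists (L *m E *m invmx L); split=> m.
  by apply/orthG; rewrite GE !mulmxA mulmxKV // -[m *m L *m E *m Dm]mulmxA ED mulmx0 mul0mx.
move=> /orthG; rewrite GE !mulmxA => /(congr1 (fun X => X *m invmx Q)).
rewrite mulmxK // mul0mx; set z := m *m L => zD.
suff zE : z *m E = z by rewrite zE /z mulmxK.
apply/matrixP => a i; rewrite ord1 mxE (bigD1 i) //= big1 ?addr0 => [|k ki]; last first.
  by rewrite [E k i]mxE (negbTE ki) mulr0.
rewrite [E i i]mxE eqxx /=; case: eqP => [|/eqP Di]; first by rewrite mulr1.
rewrite mulr0; apply/esym.
have [j Dij] : exists j, Dm i j != 0.
  apply: contrapT => no; move/eqP: Di; apply; apply/matrixP => b j.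
  by rewrite !mxE; apply: contrapT => h; apply: no; exists j; apply/eqP; rewrite mxE.
have : (z *m Dm) 0 j = 0 by rewrite zD mxE.
rewrite mxE (bigD1 i) //= big1 ?addr0 => [/eqP|k ki].
  by rewrite mulf_eq0 (negbTE Dij) orbF => /eqP.
rewrite [Dm k j]mxE; move: Dij; rewrite [Dm i j]mxE; have [ij|] := eqVneq (i : nat) j; last by rewrite mulr0n eqxx.
move=> _; case: eqP => kj; last by rewrite mulr0n mulr0.
by case/eqP: ki; apply/val_inj; rewrite /= ij.
Qed.

Lemma chart_val_int s (x : chart s) v (z : int) : orth s v -> x (z *: v) = x v ^ z.
Proof.
move=> ov; have dv := orth_dual ov.
have nat_case (k : nat) : x (k%:Z *: v) = x v ^+ k.
  by rewrite -natz scaler_nat chart_valMn.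
case: z => k; first exact: nat_case.
rewrite NegzE scaleNr -exprnN -nat_case.
have ok : orth s (k.+1%:Z *: v) by move=> w sw; rewrite -natz scaler_nat evMn ov ?mul0rn.
have := chart_valD x (orth_dual ok) (orth_dualN ok).
rewrite subrr chart_val0 => /esym E.
have x0 : x (k.+1%:Z *: v) != 0.
  by apply: contra_eq_neq E => ->; rewrite mul0r eq_sym oner_neq0.
by apply: (mulfI x0); rewrite E divff.
Qed.

(** The character of s^perp given by x extends to all of M, by composition with
    a retraction, and a character of Z^n is a monomial in its values on the
    basis. *)
Lemma central_monomial s (x : chart s) : rational_polyhedral s -> central x ->
  exists2 y : 'I_n -> R[i], forall j, y j != 0 &
    forall m, orth s m -> x m = \prod_j y j ^ m 0 j.
Proof.
move=> rs cx; have [pi [pi1 pi2]] := orth_retract rs.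
have orow j : orth s (row j pi) by rewrite rowE; exact: pi1.
exists (fun j => x (row j pi)).
  by move=> j; apply: (cx _ (orth_dual (orow j))).2.
move=> m om; rewrite -{1}(pi2 m om) mulmx_sum_row.
have oZ j : orth s (m 0 j *: row j pi).
  by rewrite rowE scalemxAl; exact: pi1.
have [_ ->] := chart_val_sum x (fun j => orth_dual (oZ j)).
by apply: eq_bigr => j _; rewrite chart_val_int.
Qed.

End Transition.

(** * Unions of arithmetic progressions *)

Section Progressions.

Lemma progs_finite (S : set nat) b : (forall k, S k -> (k < b)%N) ->
  finite_union_of_arith_progs S.
Proof.
move=> h; exists [seq (k, 0%N) | k <- iota 0 b & `[< S k >]].
apply/seteqP; split=> [k Sk|k /= [_ /mapP[i + ->] [j ->]]].
  exists (k, 0%N); last by exists 0%N; rewrite muln0 addn0.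
  by apply: map_f; rewrite mem_filter asboolT //= mem_iota add0n h.
by rewrite mem_filter mul0n addn0 => /andP[/asboolP].
Qed.

Lemma progs_dichotomy (S : set nat) :
  ((forall b, exists2 k, (b < k)%N & S k) -> forall k, S k) ->
  finite_union_of_arith_progs S.
Proof.
move=> h; have [/h hS|/existsNP[b hb]] := pselect (forall b, exists2 k, (b < k)%N & S k).
  exists [:: (0%N, 1%N)]; apply/seteqP; split=> // k _.
  by exists (0%N, 1%N); rewrite ?inE //; exists k; rewrite mul1n.
apply: (@progs_finite _ b.+1) => k Sk; rewrite ltnS leqNgt; apply/negP => bk.
by apply: hb; exists k.
Qed.

Lemma progs_split (S : set nat) k0 q : (0 < q)%N ->
  (forall a, (a < q)%N -> finite_union_of_arith_progs [set l | S (k0 + a + q * l)%N]) ->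
  finite_union_of_arith_progs S.
Proof.
move=> q0 h.
have /choice[L LP] : forall a, exists L : seq (nat * nat), (a < q)%N ->
    forall l, S (k0 + a + q * l)%N <-> exists2 p, p \in L & arith_prog p.1 p.2 l.
  move=> a; have [/h[L LE]|] := ltnP a q; last by exists [::].
  by exists L => _ l; have := congr1 (fun X : set nat => X l) LE => /= ->.
exists ([seq (k, 0%N) | k <- iota 0 k0 & `[< S k >]] ++
  flatten [seq [seq ((k0 + a + q * p.1)%N, (q * p.2)%N) | p <- L a] | a <- iota 0 q]).
apply/seteqP; split=> k /=.
  move=> Sk; have [kk0|k0k] := ltnP k k0.
    exists (k, 0%N); last by exists 0%N; rewrite muln0 addn0.
    by rewrite mem_cat map_f // mem_filter asboolT //= mem_iota add0n.
  pose a := ((k - k0) %% q)%N; pose l := ((k - k0) %/ q)%N.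
  have aq : (a < q)%N by rewrite ltn_mod.
  have kE : k = (k0 + a + q * l)%N.
    by rewrite -addnA [(a + _)%N]addnC mulnC -divn_eq subnKC.
  have /(LP a aq)[p pL [i lE]] : S (k0 + a + q * l)%N by rewrite -kE.
  exists ((k0 + a + q * p.1)%N, (q * p.2)%N); last first.
    by exists i => /=; rewrite kE lE mulnDr mulnA addnA.
  rewrite mem_cat; apply/orP; right; apply/flattenP.
  exists [seq ((k0 + a + q * p.1)%N, (q * p.2)%N) | p <- L a].
    by apply: map_f; rewrite mem_iota.
  exact: (map_f (fun p : nat * nat => ((k0 + a + q * p.1)%N, (q * p.2)%N))).
move=> [p + [i ->]]; rewrite mem_cat => /orP[/mapP[j + ->] /=|].
  by rewrite mem_filter mul0n addn0 => /andP[/asboolP].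
move=> /flattenP[_ /mapP[a + ->] /mapP[p' p'L ->]] /=; rewrite mem_iota /= add0n => aq.
have -> : (k0 + a + q * p'.1 + q * p'.2 * i = k0 + a + q * (p'.1 + p'.2 * i))%N.
  by rewrite mulnDr mulnA addnA.
by apply/(LP a aq); exists p' => //; exists i.
Qed.

End Progressions.

(** * The orbit of a point *)

Lemma det_power n (A : 'M[int]_n) q : \det (A ^+ q) = \det A ^+ q.
Proof.
elim: q => [|q IH]; first by rewrite !expr0 det1.
by rewrite !exprS -mulmxE det_mulmx IH.
Qed.

Section Orbit.
Variables (R : realType) (n : nat) (D : fan R n) (A : 'M[int]_n).

(** Elements of the coordinate ring are functions on the chart of one cone; as
    lists of terms, the equations of Y can be evaluated at any function on M. *)
Lemma closed_chart (Y : set (toric_variety D)) s (hs : cones D s) : closed Y ->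
  exists Ls : set (seq (R[i] * 'rV[int]_n)),
    (forall L, Ls L -> forall z, z \in L -> dual_semigroup s z.2) /\
    forall x, Y (of_chart hs x) <-> forall L, Ls L -> \sum_(z <- L) z.1 * x z.2 = 0.
Proof.
rewrite -openC => oY; have [I hI IE] := oY s hs.
exists [set L : seq (R[i] * 'rV[int]_n) | (forall z, z \in L -> dual_semigroup s z.2) /\
  I (fun x => \sum_(z <- L) z.1 * x z.2)]; split; first by move=> L [].
move=> x; split=> [Yx L [_ IL]|h]; first by apply: ((IE x).1 _ _ IL) => /(_ Yx).
apply: contrapT => nY; have : ~ (~` Y) (of_chart hs x); last by apply.
apply/IE => f If; have [L hL fE] := hI f If.
rewrite fE; apply: h; split => //.
by rewrite (_ : (fun x => _) = f) //; apply/funext => x'; rewrite fE.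
Qed.

(** The values are recorded as a function on M, whose type does not depend on
    the cone. *)
Definition central_reading (P : toric_variety D) (s : set 'cV[R]_n) (f : 'rV[int]_n -> R[i]) :=
  exists (hs : cones D s) (x : chart s), [/\ P = of_chart hs x, central x & f = x].

Variables (P : toric_variety D) (hP : forward_defined A P).
Let Q k := iter k (monomial_map A) P.

Lemma orbit_reading : exists (s : nat -> set 'cV[R]_n) (f : nat -> 'rV[int]_n -> R[i]),
  [/\ forall k, central_reading (Q k) (s k) (f k),
      forall k, transition A (s k) (s k.+1) &
      forall k m, dual_semigroup (s k.+1) m -> f k.+1 m = f k (m *m A)].
Proof.
have /choice[sf sfP] : forall k, exists sf, central_reading (Q k) sf.1 sf.2.
  move=> k; have [s [hs [x [E cx]]]] := exists_central (Q k).
  by exists (s, x : 'rV[int]_n -> R[i]), hs, x.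
have step k m : dual_semigroup (sf k.+1).1 m ->
    dual_semigroup (sf k).1 (m *m A) /\ (sf k.+1).2 m = (sf k).2 (m *m A).
  have [hs [x [E cx ->]]] := sfP k; have [ht [y [E' cy ->]]] := sfP k.+1.
  have ext : extends_at A (Q k) (Q k.+1).
    have [Z hZ] := hP k; rewrite /Q iterS.
    by apply: (@xgetPex _ _ [set Z | extends_at A (Q k) Z]); exists Z.
  exact: extends_at_val ext E cx E'.
exists (fun k => (sf k).1), (fun k => (sf k).2); split => //.
- move=> k m hm; have [h1 h2] := step k m hm; split => //.
  have [hs [x [E cx fE]]] := sfP k; have [ht [y [E' cy gE]]] := sfP k.+1.
  rewrite -(cy _ hm) -(cx _ h1); move: h2; rewrite fE gE => -> //.
- by move=> k m /step[].
Qed.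

(** Two of the finitely many cones coincide, and from then on the sequence
    repeats itself. *)
Lemma orbit_periodic (s : nat -> set 'cV[R]_n) : (forall k, cones D (s k)) ->
  (forall k, transition A (s k) (s k.+1)) ->
  exists k0 q, (0 < q)%N /\ forall a l, s (k0 + a + q * l)%N = s (k0 + a)%N.
Proof.
move=> hs tr.
have [i [j [ij sij]]] : exists i j, (i < j)%N /\ s i = s j.
  apply: contrapT => no.
  have inj : injective s.
    move=> i j sij; have [ij|ij|//] := ssrnat.ltngtP i j.
      by case: no; exists i, j.
    by case: no; exists j, i; split => //; exact/esym.
  apply: infinite_nat; have := finite_preimage (f := s) _ (cones_finite D).
  rewrite (_ : s @^-1` _ = setT); last by apply/seteqP; split=> // k _; exact: hs.
  by apply => x y _ _; exact: inj.
have shift a : s (j + a)%N = s (i + a)%N.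
  elim: a => [|a IH]; first by rewrite !addn0.
  rewrite !addnS; apply: (transition_unique (hs (i + a)%N) (hs _) (hs _) _ (tr _)).
  by rewrite -IH; exact: tr.
exists i, (j - i)%N; split; first by rewrite subn_gt0.
move=> a l; elim: l => [|l IH]; first by rewrite muln0 addn0.
rewrite -IH mulnS.
have -> : (i + a + (j - i + (j - i) * l) = j + (a + (j - i) * l))%N by lia.
by rewrite shift addnA.
Qed.

Lemma orbit_values (s : nat -> set 'cV[R]_n) (f : nat -> 'rV[int]_n -> R[i]) :
  (forall k, transition A (s k) (s k.+1)) ->
  (forall k m, dual_semigroup (s k.+1) m -> f k.+1 m = f k (m *m A)) ->
  forall k l m, dual_semigroup (s (k + l)%N) m ->
  dual_semigroup (s k) (m *m A ^+ l) /\ f (k + l)%N m = f k (m *m A ^+ l).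
Proof.
move=> tr fE k; elim=> [|l IH] m; first by rewrite addn0 expr0 mulmx1.
rewrite addnS => hm; have [h1 _] := tr _ _ hm.
by have [h2 h3] := IH _ h1; rewrite exprS -mulmxE mulmxA fE.
Qed.

End Orbit.

Theorem theoremB (R : realType) (n : nat) (D : fan R n) (A : 'M[int]_n)
    (hA : \det A != 0) (Y : set (toric_variety D)) (hY : closed Y)
    (P : toric_variety D) (hP : forward_defined A P) :
  finite_union_of_arith_progs [set k | Y (iter k (monomial_map A) P)].
Proof.
have [s [f [hr tr fE]]] := orbit_reading hP.
have hs k : cones D (s k) by have [] := hr k.
have [k0 [q [q0 per]]] := orbit_periodic hs tr.
apply: (progs_split q0 (k0 := k0)) => a _.
set t := s (k0 + a)%N in per *.
have [ht [x [xE cx fx]]] := hr (k0 + a)%N.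
have [y y0 yE] := central_monomial (cones_rational ht) cx.
pose B := A ^+ q.
have dB : \det B != 0 by rewrite /B det_power expf_neq0.
have [k1 [N [N0 HN]]] := monomial_orbit y0 dB.
have [Ls [LsD LsY]] := closed_chart ht hY.
have val l m : dual_semigroup t m ->
    f (k0 + a + q * l)%N m = if `[< orth t m >] then \prod_j y j ^ (m *m B ^+ l) 0 j else 0.
  move=> hm; have hm' : dual_semigroup (s (k0 + a + q * l)%N) m by rewrite per.
  have [h1 h2] := orbit_values tr fE hm'.
  have BE : A ^+ (q * l) = B ^+ l by rewrite exprM.
  have [h [z [_ cz fz]]] := hr (k0 + a + q * l)%N.
  have zm := cz _ hm'; rewrite -fz h2 per -/t fx BE in zm.
  rewrite h2 fx BE; case: asboolP => ho.
    by apply: yE; apply: (cx _ _).1; [rewrite -BE | apply/zm].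
  by apply: contrapT => /eqP/zm.
have memY l : Y (iter (k0 + a + q * l) (monomial_map A) P) <->
    forall L, Ls L -> \sum_(z <- L) z.1 * f (k0 + a + q * l)%N z.2 = 0.
  have [h [z [-> _ ->]]] := hr (k0 + a + q * l)%N.
  move: h z; rewrite per -/t => h z; rewrite (Prop_irrelevance h ht).
  exact: LsY.
apply: (progs_split N0 (k0 := k1)) => r _.
apply: progs_dichotomy => hinf l; rewrite /= memY => L hL.
(* The terms with exponent outside the orthogonal of t vanish on the class. *)
pose L' := [seq z <- L | `[< orth t z.2 >]].
have sumE e : \sum_(z <- L) z.1 * f (k0 + a + q * e)%N z.2 =
    \sum_(i < size L') (tnth (in_tuple L') i).1 *
      \prod_j y j ^ ((tnth (in_tuple L') i).2 *m B ^+ e) 0 j.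
  rewrite -(big_tnth _ _ _ xpredT (fun z : R[i] * 'rV[int]_n => z.1 * \prod_j y j ^ (z.2 *m B ^+ e) 0 j)).
  rewrite big_filter [RHS]big_mkcond big_seq [RHS]big_seq; apply: eq_bigr => z zL.
  by rewrite (val e _ (LsD L hL z zL)); case: ifP => // _; rewrite mulr0.
rewrite sumE; apply: HN => b.
have [k bk /memY/(_ L hL)] := hinf b; rewrite sumE => Hk.
by exists k.
Qed.
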